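(* Let $N\in\mathbb N$, let $\mathbb X_i=(X_i,g_i,\xi_i)$, $i=1,\dots,N$, and $\mathbb Y=(Y,h,\upsilon)$ be gm-spaces, put $\mathfrak Y:=\llbracket\mathbb Y\rrbracket$, let $\rho\in\Delta_{N-1}$, and fix optimal plans $\pi_i\in\Pi_{\mathrm o}(\mathbb Y,\mathbb X_i)$. Set $\mathbb Y_i:=(Y\times X_i,h,\pi_i)\in\mathfrak Y$ and let $\mathfrak g_i:=\llbracket (g_i-h)|_{\mathbb Y_i}\rrbracket\in\mathfrak T_{\mathfrak Y}$. Then the tangential barycenter problem $$\inf_{\mathfrak f\in\mathfrak T_{\mathfrak Y}}\ \sum_{i=1}^N\rho_i\, d^2_{\mathfrak T_{\mathfrak Y}}(\mathfrak g_i,\mathfrak f)$$ admits a solution. Moreover, there exist plans $\pi_i^*\simeq_{\mathbb Y}\pi_i$, $i=1,\dots,N$, such that for some gluing $\gamma^*\in\Gamma_{\mathbb Y}(\pi_1^*,\dots,\pi_N^* )$ the tangent $$\mathfrak m_\rho:=\llbracket (m_\rho-h)|_{(Y\times X_\times,h,\gamma^* )}\rrbracket$$ is a minimizer of this problem (a tangential barycenter).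
   Context: A gauged measure space (gm-space) is a triple $\mathbb X=(X,g,\xi)$ where $X$ is a Polish space, $\xi$ is a Borel probability measure on $X$, and $g$ is a gauge, i.e. $g\in\mathfrak G(X,\xi):=L^2_{\mathrm{sym}}(X\times X,\xi\otimes\xi)$ (symmetric, real-valued, square-integrable). For gm-spaces $\mathbb X=(X,g,\xi)$, $\mathbb Y=(Y,h,\upsilon)$, $\Pi(\mathbb X,\mathbb Y)$ is the set of Borel probability measures on $X\times Y$ with marginals $\xi,\upsilon$; $F_{\mathrm{GW}}^{\mathbb X,\mathbb Y}(\pi):=\bigl(\iint |g(x,x')-h(y,y')|^2\,d\pi(x,y)\,d\pi(x',y')\bigr)^{1/2}$; $\mathrm{GW}(\mathbb X,\mathbb Y):=\inf_{\pi\in\Pi(\mathbb X,\mathbb Y)}F_{\mathrm{GW}}^{\mathbb X,\mathbb Y}(\pi)$ (the infimum is attained), and $\Pi_{\mathrm o}(\mathbb X,\mathbb Y)$ is the set of minimizers. Spaces are homomorphic, $\mathbb X\simeq\mathbb Y$, if $\mathrm{GW}(\mathbb X,\mathbb Y)=0$; $\llbracket\mathbb X\rrbracket$ denotes the equivalence class and $\mathfrak{GM}$ the set of all classes, which is a metric space under $\mathrm{GW}$. $P_\bullet$ denotes the projection onto the indicated component(s) and $\#$ the push-forward. A function defined on some factors of a product space is regarded as a function on the product via projection, e.g. $h$ on $Y\times X_i$ means $((y,x),(y',x'))\mapsto h(y,y')$. Equivalence of plans: for $\sigma\in\Pi(\mathbb X,\tilde{\mathbb X})$ and $\pi\in\Pi(\mathbb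 X,\mathbb Y)$, the set of meltings $\mathrm M_{\mathbb X}(\sigma,\pi)$ consists of all $(P_{\tilde X\times Y})_\#\gamma$ where $\gamma$ is a Borel probability measure on $X\times\tilde X\times Y$ with $(P_{X\times\tilde X})_\#\gamma=\sigma$ and $(P_{X\times Y})_\#\gamma=\pi$. Plans $\pi,\pi^*\in\Pi_{\mathrm o}(\mathbb Y,\mathbb X)$ are equivalent with respect to $\mathbb Y$, written $\pi^*\simeq_{\mathbb Y}\pi$, if there is $\sigma\in\Pi_{\mathrm o}(\mathbb Y,\mathbb Y)$ with $\pi^*\in\mathrm M_{\mathbb Y}(\sigma,\pi)$. Tangent space at $\mathfrak Y\in\mathfrak{GM}$: $\mathfrak T_{\mathfrak Y}:=\bigl(\bigcup_{(Y,h,\upsilon)\in\mathfrak Y}\mathfrak G(Y,\upsilon)\bigr)/\!\simeq$, where $f\in\mathfrak G(Y,\upsilon)$ and $\tilde f\in\mathfrak G(\tilde Y,\tilde\upsilon)$, attached to representatives $\mathbb Y=(Y,h,\upsilon)$ and $\tilde{\mathbb Y}=(\tilde Y,\tilde h,\tilde\upsilon)$ of $\mathfrak Y$, are equivalent if there is $\tau\in\Pi_{\mathrm o}(\mathbb Y,\tilde{\mathbb Y})$ with $f(y,y')=\tilde f(\tilde y,\tilde y')$ for $\tau(y,\tilde y)\otimes\tau(y',\tilde y')$-almost all arguments. The class of $f$ is $\llbracket f\rrbracket$, and $f|_{\mathbb Y}$ indicates that $f$ is attached to the representative $\mathbb Y$. The tangent metric is $$d_{\mathfrak T_{\mathfrak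 Y}}(\mathfrak f,\tilde{\mathfrak f}):=\inf_{\tau\in\Pi_{\mathrm o}(\mathbb Y,\tilde{\mathbb Y})}\Bigl(\iint|f(y,y')-\tilde f(\tilde y,\tilde y')|^2\,d\tau(y,\tilde y)\,d\tau(y',\tilde y')\Bigr)^{1/2}$$ for any $f|_{\mathbb Y}\in\mathfrak f$, $\tilde f|_{\tilde{\mathbb Y}}\in\tilde{\mathfrak f}$ (independent of the chosen representatives). Further notation: $\Delta_{N-1}:=\{\rho\in[0,1]^N:\sum_i\rho_i=1\}$; $X_\times:=X_1\times\cdots\times X_N$ with elements $x_\times=(x_1,\dots,x_N)$; $m_\rho(x_\times,x_\times'):=\sum_{i=1}^N\rho_i g_i(x_i,x_i')$; for $\pi_i\in\Pi(\mathbb Y,\mathbb X_i)$, the set of gluings $\Gamma_{\mathbb Y}(\pi_1,\dots,\pi_N)$ is the set of Borel probability measures $\gamma$ on $Y\times X_\times$ with $(P_{Y\times X_i})_\#\gamma=\pi_i$ for all $i$. Then $(Y\times X_\times,h,\gamma)\in\mathfrak Y$. *)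

(* Defs.v *)
From HB Require Import structures.
From mathcomp Require Import all_boot all_order all_algebra.
From mathcomp Require Import all_classical all_reals all_analysis.
From mathcomp Require Import measurable_realfun.

Set Implicit Arguments.
Unset Strict Implicit.
Unset Printing Implicit Defensive.

Import Order.TTheory GRing.Theory Num.Theory.
Import numFieldNormedType.Exports.

Local Open Scope classical_set_scope.
Local Open Scope ring_scope.

Section Polish.
Context {R : realType}.

Definition is_metric (T : Type) (d : T -> T -> R) : Prop :=
  [/\ forall x y, d x y = 0 <-> x = y,
      forall x y, d x y = d y x &
      forall y x z, d x z <= d x y + d y z].

Definition metrizes (T : topologicalType) (d : T -> T -> R) : Prop :=
  forall (x : T) (A : set T),
    nbhs x A <-> exists2 e, 0 < e & [set y | d x y < e] `<=` A.

Definition complete_metric (T : topologicalType) (d : T -> T -> R) : Prop :=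
  forall u : nat -> T,
    (forall e, 0 < e -> exists n0, forall m n,
       (n0 <= m)%N -> (n0 <= n)%N -> d (u m) (u n) < e) ->
    exists l : T, u @ \oo --> l.

Definition polish (T : topologicalType) : Prop :=
  (exists2 D : set T, countable D & dense D) /\
  exists d : T -> T -> R, [/\ is_metric d, metrizes d & complete_metric d].

Lemma metric_ge0 T (d : T -> T -> R) : is_metric d -> forall x y, 0 <= d x y.
Proof.
move=> [d0 ds dt] x y; have := dt y x x.
by rewrite (d0 x x).2// (ds y x) -mulr2n pmulrn_lge0.
Qed.

Lemma cvg_metric (T : topologicalType) (d : T -> T -> R) (u : nat -> T) l :
  metrizes d ->
  u @ \oo --> l <-> forall e, 0 < e -> \forall n \near \oo, d l (u n) < e.
Proof.
move=> md; split=> [ul e e0|ul A /md[e e0 eA]].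
  by apply: (ul [set y | d l y < e]); apply/md; exists e.
by apply: filterS (ul e e0) => n /= ?; exact: eA.
Qed.

Lemma sum_div_lt n (r : R) : 0 < r -> \sum_(i < n) r / n.+1%:R < r.
Proof.
move=> r0; rewrite sumr_const card_ord -(mulr_natr (r / _)) -mulrA gtr_pMr//.
by rewrite mulrC ltr_pdivrMr// mul1r ltr_nat.
Qed.

Lemma polish_prod (T U : topologicalType) :
  polish T -> polish U -> polish (T * U)%type.
Proof.
move=> [[D cD dD] [d [dm dM dc]]] [[E cE dE] [e [em eM ec]]].
split.
  exists (D `*` E); first exact: countableX.
  move=> O [[x y] Oxy] oO.
  have : nbhs (x, y) O by apply: open_nbhs_nbhs.
  move=> [[A B] /= [nA nB] AB].
  have [p [/interior_subset Ap Dp]] :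
    A° `&` D !=set0 by apply: dD; [exists x|exact: open_interior].
  have [q [/interior_subset Bq Eq]] :
    B° `&` E !=set0 by apply: dE; [exists y|exact: open_interior].
  by exists (p, q); split => //; apply: AB.
pose c (z w : T * U) := Num.max (d z.1 w.1) (e z.2 w.2).
have dge0 := metric_ge0 dm; have ege0 := metric_ge0 em.
case: dm => d0 ds dt; case: em => e0 es et.
have cM : metrizes c.
  move=> [x y] A; split.
    move=> [[P Q] /= [/dM[r r0 rP] /eM[s s0 sQ]] PQ].
    exists (Num.min r s); first by rewrite lt_min r0.
    move=> [a b]; rewrite /c /= gt_max !lt_min => /andP[/andP[? _] /andP[_ ?]].
    by apply: PQ; split => /=; [exact: rP|exact: sQ].
  move=> [r r0 rA]; exists ([set a | d x a < r], [set b | e y b < r]).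
    by split => /=; [apply/dM|apply/eM]; exists r.
  by move=> [a b] [/= ? ?]; apply: rA; rewrite /c /= gt_max; apply/andP.
exists c; split => //.
- split.
  + move=> [x y] [x' y']; rewrite /c/=; split; last first.
      by move=> [-> ->]; rewrite (d0 _ _).2// (e0 _ _).2// maxxx.
    move=> c0; have := le_max (d x x') (d x x') (e y y').
    have := le_max (e y y') (d x x') (e y y').
    rewrite c0 !lexx !orbT /= => ey dx.
    by congr pair; [apply/d0|apply/e0]; apply/eqP; rewrite eq_le ?dx ?ey ?dge0 ?ege0.
  + by move=> z w; rewrite /c ds es.
  + move=> y x z; rewrite /c ge_max; apply/andP; split.
      by apply: le_trans (dt y.1 _ _) _; rewrite lerD// le_max lexx.
    by apply: le_trans (et y.2 _ _) _; rewrite lerD// le_max lexx orbT.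
- move=> u uc.
  have [l1 ul1] : exists l : T, (fst \o u) @ \oo --> l.
    apply: dc => r /uc[n0 un0]; exists n0 => m n m0 n0'.
    by apply: le_lt_trans (un0 m n m0 n0'); rewrite /c le_max lexx.
  have [l2 ul2] : exists l : U, (snd \o u) @ \oo --> l.
    apply: ec => r /uc[n0 un0]; exists n0 => m n m0 n0'.
    by apply: le_lt_trans (un0 m n m0 n0'); rewrite /c le_max lexx orbT.
  exists (l1, l2); apply/(cvg_metric _ _ cM) => r r0.
  move/(cvg_metric _ _ dM) : ul1 => /(_ _ r0) h1.
  move/(cvg_metric _ _ eM) : ul2 => /(_ _ r0) h2.
  by apply: filterS2 h1 h2 => n ? ?; rewrite /c /= gt_max; apply/andP.
Qed.

Lemma polish_prod_topology n (T : 'I_n -> topologicalType) :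
  (forall i, inhabited (T i)) ->
  (forall i, polish (T i)) -> polish (prod_topology T).
Proof.
move=> Tn Tp.
have hDe i : exists D : set (T i), countable D /\ dense D.
  by have [[D cD dD] _] := Tp i; exists D.
have hde i : exists d : T i -> T i -> R,
    [/\ is_metric d, metrizes d & complete_metric d] by have [] := Tp i.
pose D i := projT1 (cid (hDe i)).
have hD i : countable (D i) /\ dense (D i) := projT2 (cid (hDe i)).
pose d i := projT1 (cid (hde i)).
have hd i : [/\ is_metric (d i), metrizes (d i) & complete_metric (d i)] :=
  projT2 (cid (hde i)).
have d_ge0 i : forall x y, 0 <= d i x y by case: (hd i) => /metric_ge0.
pose c (x y : prod_topology T) := \sum_(i < n) d i (x i) (y i).
have dc i x y : d i (x i) (y i) <= c x y.
  by rewrite /c (bigD1 i)//= lerDl sumr_ge0.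
have cM : metrizes c.
  move=> x A; split; last first.
    move=> [e e0 eA].
    pose r := e / n.+1%:R.
    have r0 : 0 < r by rewrite divr_gt0.
    have : \forall y \near x, forall i, d i (x i) (y i) < r.
      have := @filter_forall (prod_topology T) 'I_n
        (fun i => [set y | d i (x i) (y i) < r]) (nbhs x) _.
      apply=> i.
      have := @proj_continuous _ T i x [set a | d i (x i) a < r].
      by apply; case: (hd i) => _ dM _; apply/dM; exists r.
    apply: filterS => y xy; apply: eA; rewrite /= /c.
    apply: (@le_lt_trans _ _ (\sum_(i < n) r)).
      by apply: ler_sum => i _; apply/ltW/xy.
    exact: sum_div_lt.
  pose F : set_system (prod_topology T) :=
    [set A | exists2 e, 0 < e & [set y | c x y < e] `<=` A].
  have FF : Filter F.
    split.
    - by exists 1.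
    - move=> P Q [e e0 eP] [f f0 fQ]; exists (Num.min e f); first by rewrite lt_min e0.
      by move=> y /=; rewrite lt_min => /andP[? ?]; split; [exact: eP|exact: fQ].
    - by move=> P Q PQ [e e0 eP]; exists e => // y /eP /PQ.
  have : F --> x.
    apply/cvg_sup => i B.
    have -> := @nbhsE (initial_topology (fun f : (forall i, T i) => f i)) x.
    move=> [C [[V oV VC] Cx] CB].
    have : nbhs (x i) V by apply: open_nbhs_nbhs; split => //; rewrite -VC in Cx.
    case: (hd i) => _ dM _ /dM[e e0 eV]; exists e => // y /= xy.
    by apply: CB; rewrite -VC; apply: eV => /=; exact: le_lt_trans xy.
  by move=> /(_ A).
split.
  have De i : exists f : nat -> T i, range f = D i.
    have [cD dD] := hD i.
    have [t] := Tn i.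
    have [a [_ Da]] : [set: T i] `&` D i !=set0 by apply: dD => //; [exists t|exact: openT].
    have /pfcard_geP[D0|[f]] := cD; first by move: Da; rewrite D0.
    by exists f; apply/image_eq.
  pose e i := projT1 (cid (De i)).
  have eD i : range (e i) = D i := projT2 (cid (De i)).
  pose h (f : {ffun 'I_n -> nat}) : prod_topology T := fun i => e i (f i).
  exists (range h); first exact: sub_countable (card_image_le _ _) (countableP _).
  move=> O [x Ox] oO.
  have /cM[r r0 rO] : nbhs x O by apply: open_nbhs_nbhs.
  pose s := r / n.+1%:R.
  have s0 : 0 < s by rewrite divr_gt0.
  have /choice[g gP] : forall i, exists k, d i (x i) (e i k) < s.
    move=> i; have [cD dD] := hD i.
    have : ([set a | d i (x i) a < s])° `&` D i !=set0.
      apply: dD; last exact: open_interior.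
      by exists (x i); rewrite /interior; case: (hd i) => _ dM _; apply/dM; exists s.
    by move=> [a [/interior_subset/= xa]]; rewrite -eD => -[k _ ka]; exists k; rewrite ka.
  exists (h [ffun i => g i]); split; last by exists [ffun i => g i].
  apply: rO; rewrite /= /c.
  apply: (@le_lt_trans _ _ (\sum_(i < n) s)).
    by apply: ler_sum => i _; rewrite /h ffunE; apply/ltW/gP.
    exact: sum_div_lt.
exists c; split => //.
- split.
  + move=> x y; split.
      move=> cxy; apply: functional_extensionality_dep => i.
      case: (hd i) => -[d0 _ _] _ _; apply/d0/eqP.
      by rewrite eq_le d_ge0 andbT -cxy dc.
    by move=> ->; rewrite /c big1// => i _; case: (hd i) => -[d0 _ _] _ _; apply/d0.
  + by move=> x y; apply: eq_bigr => i _; case: (hd i) => -[_ ds _] _ _.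
  + move=> y x z; rewrite /c -big_split/=; apply: ler_sum => i _.
    by case: (hd i) => -[_ _ dt] _ _.
- move=> u uc.
  have hl i : exists l : T i, (fun k => u k i) @ \oo --> l.
    case: (hd i) => _ _ dcc; apply: dcc => r /uc[n0 un0].
    by exists n0 => p q p0 q0; apply: le_lt_trans (un0 p q p0 q0).
  pose l i := projT1 (cid (hl i)).
  have ul i : (fun k => u k i) @ \oo --> l i := projT2 (cid (hl i)).
  exists l; apply/(cvg_metric _ _ cM) => r r0.
  pose s := r / n.+1%:R.
  have s0 : 0 < s by rewrite divr_gt0.
  have : \forall k \near \oo, forall i, d i (l i) (u k i) < s.
    apply: filter_forall => i; case: (hd i) => _ dM _.
    by move/(cvg_metric _ _ dM): (ul i); apply.
  apply: filterS => k lk.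
  apply: (@le_lt_trans _ _ (\sum_(i < n) s)).
    by apply: ler_sum => i _; apply/ltW/lk.
    exact: sum_div_lt.
Qed.

End Polish.

HB.instance Definition _ (T U : ptopologicalType) := Pointed.on (T * U)%type.
HB.instance Definition _ (I : Type) (T : I -> ptopologicalType) :=
  Pointed.copy (prod_topology T) (forall i, T i).

Notation borel T := (g_sigma_algebraType (@open T)).

Lemma continuous_borel (T U : ptopologicalType) (f : T -> U) :
  continuous f -> measurable_fun setT (f : borel T -> borel U).
Proof.
move=> cf; apply: (@measurability _ _ (borel T) (borel U) setT f (@open U) erefl) => _ [A oA <-].
rewrite setTI; apply: sub_sigma_algebra.
by apply: open_comp => // x _; exact: cf.
Qed.

Lemma measurable_map2 d1 d2 (S : measurableType d1) (T : measurableType d2)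
    (f : S -> T) : measurable_fun setT f ->
  measurable_fun setT (fun z : S * S => (f z.1, f z.2)).
Proof.
move=> mf; apply: measurable_fun_pair.
  exact: (measurableT_comp mf measurable_fst).
exact: (measurableT_comp mf measurable_snd).
Qed.

Section Pushforward.
Context {R : realType}.

(* Two measures are only compared on measurable sets: the library leaves the
   value of a measure on other sets unspecified. *)
Definition pushes_to d1 d2 (S : measurableType d1) (T : measurableType d2)
    (mu : {measure set S -> \bar R}) (f : S -> T)
    (nu : {measure set T -> \bar R}) : Prop :=
  forall A, measurable A -> pushforward mu f A = nu A.

Context d1 d2 (S : measurableType d1) (T : measurableType d2).
Variables (mu : probability S R) (nu : probability T R) (f : S -> T).
Hypotheses (mf : measurable_fun setT f) (munu : pushes_to mu f nu).

Let f2 (z : S * S) := (f z.1, f z.2).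

Lemma pushes_prod (A : set (T * T)) :
  measurable A -> (mu \x mu)%E (f2 @^-1` A) = (nu \x nu)%E A.
Proof.
move=> mA.
pose m' := measure_function_pushforward__canonical__measure_function_Measure
  (mu \x mu)%E (measurable_map2 mf).
rewrite (@product_measure_unique _ _ _ _ _ nu nu m')// => B C mB mC.
rewrite /m' /= /pushforward.
have -> : f2 @^-1` (B `*` C) = (f @^-1` B) `*` (f @^-1` C) by [].
rewrite product_measure1E; first by rewrite -!munu.
- by rewrite -[X in measurable X]setTI; exact: mf.
- by rewrite -[X in measurable X]setTI; exact: mf.
Qed.

Lemma pushes_integral (g : T * T -> \bar R) :
  measurable_fun setT g -> (forall z, 0 <= g z)%E ->
  (\int[nu \x nu]_z g z = \int[mu \x mu]_z g (f2 z))%E.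
Proof.
move=> mg g0; have mf2 := measurable_map2 mf.
rewrite -(@ge0_integral_pushforward _ _ _ _ _ _ mf2 _ setT)//.
pose m' := measure_function_pushforward__canonical__measure_function_Measure
  (mu \x mu)%E mf2.
by rewrite -(@eq_measure_integral _ _ _ _ (nu \x nu)%E m')// => A mA _;
  exact: pushes_prod.
Qed.

Lemma pushes_ae (P : T * T -> Prop) :
  {ae (nu \x nu)%E, forall z, P z} -> {ae (mu \x mu)%E, forall z, P (f2 z)}.
Proof.
move=> [A [mA A0 PA]]; exists (f2 @^-1` A); split.
- by rewrite -[X in measurable X]setTI; exact: measurable_map2.
- by rewrite pushes_prod.
- by move=> z Pz; apply: PA.
Qed.

Lemma pushes_Lnorm (g : T * T -> R) : measurable_fun setT g ->
  'N[(mu \x mu)%E]_2%:E[EFin \o (g \o f2)]%E =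
  'N[(nu \x nu)%E]_2%:E[EFin \o g]%E.
Proof.
move=> mg; rewrite unlock; congr (_ `^ _)%E; rewrite pushes_integral//.
  apply: (@measurableT_comp _ _ _ _ _ _ (fun x : \bar R => x `^ 2)%E).
    exact: measurable_poweR.
  by apply: measurableT_comp => //; exact/measurable_EFinP.
by move=> z; exact: poweR_ge0.
Qed.

End Pushforward.

Section PushProbability.
Context {R : realType} d1 d2 (S : measurableType d1) (T : measurableType d2).
Variables (mu : probability S R) (f : S -> T).
Hypothesis mf : measurable_fun setT f.

Definition push_mfun : {mfun S >-> T} :=
  HB.pack f (isMeasurableFun.Build _ _ _ _ _ mf).

Definition push_prob : probability T R := distribution mu push_mfun.

Lemma push_probE : pushes_to mu f push_prob. Proof. by []. Qed.

End PushProbability.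

Section GaugedSpaces.
Context {R : realType}.

(* An element of L^2_sym is given by a representing function; symmetry is
   therefore only required almost everywhere. *)
Definition is_gauge (T : ptopologicalType) (mu : probability (borel T) R)
    (g : borel T * borel T -> R) : Prop :=
  (g \in Lfun (mu \x mu)%E 2%:E) /\
  {ae (mu \x mu)%E, forall z, g z = g (z.2, z.1)}.

Lemma gauge_measurable (T : ptopologicalType) (mu : probability (borel T) R)
    (g : borel T * borel T -> R) : is_gauge mu g -> measurable_fun setT g.
Proof. by move=> [/sub_Lfun_mfun]; rewrite inE. Qed.

Lemma gauge_comp (T U : ptopologicalType) (mu : probability (borel T) R)
    (nu : probability (borel U) R) (f : T -> U)
    (g : borel U * borel U -> R) :
  continuous f -> pushes_to mu (f : borel T -> borel U) nu ->
  is_gauge nu g -> is_gauge mu (fun z => g (f z.1, f z.2)).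
Proof.
move=> cf munu gg; have mg := gauge_measurable gg.
have mf := continuous_borel cf.
case: gg => gL gs; split; last exact: (pushes_ae mf munu gs).
rewrite inE; apply/andP; split; rewrite inE/=.
  exact: measurableT_comp mg (measurable_map2 mf).
rewrite /finite_norm (pushes_Lnorm mf munu mg).
by move: gL; rewrite inE => /andP[_]; rewrite inE.
Qed.

Section GaugeLinear.
Variables (T : ptopologicalType) (mu : probability (borel T) R).
Implicit Types g h : borel T * borel T -> R.

Lemma gauge0 : is_gauge mu (fun=> 0).
Proof.
split; last by apply: aeW.
by have [] := Lfun_submod_closed (mu \x mu)%E (lee1n 2 : (1 <= 2%:E :> \bar R)%E).
Qed.

Lemma gauge_lin (a : R) g h :
  is_gauge mu g -> is_gauge mu h -> is_gauge mu (fun z => a * g z + h z).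
Proof.
move=> [gL gs] [hL hs]; split; last by apply: filterS2 gs hs => z -> ->.
have [_ lin] :=
  Lfun_submod_closed (mu \x mu)%E (lee1n 2 : (1 <= 2%:E :> \bar R)%E).
exact: lin.
Qed.

Lemma gaugeB g h :
  is_gauge mu g -> is_gauge mu h -> is_gauge mu (fun z => g z - h z).
Proof.
move=> gg hg; have := gauge_lin (-1) hg gg.
by congr is_gauge; apply/funext => z; rewrite mulN1r addrC.
Qed.

Lemma gauge_sum n (c : 'I_n -> R) (g : 'I_n -> borel T * borel T -> R) :
  (forall i, is_gauge mu (g i)) ->
  is_gauge mu (fun z => \sum_(i < n) c i * g i z).
Proof.
elim: n c g => [|n IH] c g gg.
  by under eq_fun do rewrite big_ord0; exact: gauge0.
under eq_fun do rewrite big_ord_recl.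
by apply: gauge_lin => //; apply: IH => i; exact: gg.
Qed.

End GaugeLinear.

Record gmSpace := GMSpace {
  gm_space :> ptopologicalType ;
  gm_polish : @polish R gm_space ;
  gm_law : probability (borel gm_space) R ;
  gm_gauge : borel gm_space * borel gm_space -> R ;
  gm_gaugeP : is_gauge gm_law gm_gauge }.

Arguments gm_gauge : clear implicits.

Record plan (X Y : gmSpace) := Plan {
  plan_law :> probability (borel (X * Y)%type) R ;
  plan_fst : pushes_to plan_law
    (fst : borel (X * Y)%type -> borel X) (gm_law X) ;
  plan_snd : pushes_to plan_law
    (snd : borel (X * Y)%type -> borel Y) (gm_law Y) }.

(* (\iint |f(x,x') - f'(y,y')|^2 dpi(x,y) dpi(x',y'))^(1/2) *)
Definition L2_cost (X Y : gmSpace) (pi : plan X Y)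
    (f : borel X * borel X -> R) (f' : borel Y * borel Y -> R) : \bar R :=
  'N[(pi \x pi)%E]_2%:E[
    EFin \o (fun z : borel (X * Y)%type * borel (X * Y)%type =>
      f (z.1.1, z.2.1) - f' (z.1.2, z.2.2))%R]%E.

Definition FGW (X Y : gmSpace) (pi : plan X Y) : \bar R :=
  L2_cost pi (gm_gauge X) (gm_gauge Y).

Definition GW (X Y : gmSpace) : \bar R := ereal_inf (range (@FGW X Y)).

Definition optimal (X Y : gmSpace) : set (plan X Y) :=
  [set pi | FGW pi = GW X Y].

(* Collections of gm-spaces and of tangents are predicates rather than objects
   of type "set _", whose universe is below that of gmSpace. *)
Definition gm_class (Y : gmSpace) : gmSpace -> Prop := fun Z => GW Y Z = 0%E.

Definition melting (X X' Y : gmSpace) (sigma : plan X X') (pi : plan X Y) :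
    set (plan X' Y) :=
  [set pi' | exists gamma : probability (borel (X * X' * Y)%type) R,
    [/\ pushes_to gamma
          (fst : borel (X * X' * Y)%type -> borel (X * X')%type) sigma,
        pushes_to gamma
          ((fun w => (w.1.1, w.2)) :
             borel (X * X' * Y)%type -> borel (X * Y)%type) pi &
        pushes_to gamma
          ((fun w => (w.1.2, w.2)) :
             borel (X * X' * Y)%type -> borel (X' * Y)%type) pi']].

Definition plan_equiv (Y X : gmSpace) (pi' pi : plan Y X) : Prop :=
  [/\ optimal pi', optimal pi &
      exists2 sigma : plan Y Y, optimal sigma & melting sigma pi pi'].

Record tangent (C : gmSpace -> Prop) := Tangent {
  tg_base : gmSpace ;
  tg_baseP : C tg_base ;
  tg_fun : borel tg_base * borel tg_base -> R ;
  tg_funP : is_gauge (gm_law tg_base) tg_fun }.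

Arguments tg_fun {C} t _.

Definition tg_equiv C (f f' : tangent C) : Prop :=
  exists2 tau : plan (tg_base f) (tg_base f'), optimal tau &
    {ae (tau \x tau)%E, forall z :
        borel (tg_base f * tg_base f')%type * borel (tg_base f * tg_base f')%type,
      tg_fun f (z.1.1, z.2.1) = tg_fun f' (z.1.2, z.2.2)}.

Definition tspace (C : gmSpace -> Prop) : Type :=
  {A : tangent C -> Prop | exists f, A = tg_equiv f}.

Definition tclass C (f : tangent C) : tspace C :=
  exist _ (tg_equiv f) (ex_intro _ f erefl).

Definition trepr C (F : tspace C) : tangent C := projT1 (cid (projT2 F)).

(* The tangent metric does not depend on the representatives of the two
   classes, so that it may be evaluated at arbitrary ones. *)
Definition tdist C (F F' : tspace C) : \bar R :=
  let f := trepr F in let f' := trepr F' in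
  ereal_inf [set L2_cost tau (tg_fun f) (tg_fun f') | tau in
    @optimal (tg_base f) (tg_base f')].

Definition tbary_obj C N (rho : 'I_N -> R) (G : 'I_N -> tspace C)
    (F : tspace C) : \bar R :=
  (\sum_(i < N) (rho i)%:E * tdist (G i) F ^+ 2)%E.

Definition tbarycenter C N (rho : 'I_N -> R) (G : 'I_N -> tspace C) :
    tspace C -> Prop :=
  fun F => forall F', (tbary_obj rho G F <= tbary_obj rho G F')%E.

Definition simplex N : set ('I_N -> R) :=
  [set rho | (forall i, 0 <= rho i <= 1) /\ \sum_(i < N) rho i = 1].

Section Lift.
Variables (Y : gmSpace) (Z : ptopologicalType) (pZ : @polish R Z).
Variable mu : probability (borel (Y * Z)%type) R.
Hypothesis muY : pushes_to mu (fst : borel (Y * Z)%type -> borel Y) (gm_law Y).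

Let fst_cts : continuous (fst : (Y * Z)%type -> Y).
Proof. by move=> z; exact: cvg_fst. Qed.

Definition gm_lift : gmSpace :=
  @GMSpace (Y * Z)%type (polish_prod (gm_polish Y) pZ)
    _ _ (gauge_comp fst_cts muY (gm_gaugeP Y)).

Let graph_cts : continuous ((fun z => (z.1, z)) : (Y * Z)%type -> (Y * gm_lift)%type).
Proof.
move=> z A [[P Q] /= [nP nQ] PQA].
have zP : \forall w \near z, P w.1 by exact: (@cvg_fst _ _ (nbhs z.1) (nbhs z.2)).
by apply: filterS2 zP nQ => w Pw Qw; apply: PQA.
Qed.

Let graph_law : probability (borel (Y * gm_lift)%type) R :=
  push_prob mu (continuous_borel graph_cts).

Lemma gm_lift_class : gm_class Y gm_lift.
Proof.
have p1 : pushes_to graph_law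
    (fst : borel (Y * gm_lift)%type -> borel Y) (gm_law Y).
  by move=> A mA; exact: muY.
have p2 : pushes_to graph_law
    (snd : borel (Y * gm_lift)%type -> borel gm_lift) (gm_law gm_lift).
  by [].
apply/eqP; rewrite eq_le; apply/andP; split; last first.
  by apply: le_ereal_inf_tmp => _ [pi _ <-]; exact: Lnorm_ge0.
apply: ereal_inf_lbound; exists (Plan p1 p2) => //.
rewrite /FGW /L2_cost.
pose mf := continuous_borel graph_cts.
have mg : measurable_fun setT
    (fun z : borel (Y * gm_lift)%type * borel (Y * gm_lift)%type =>
      gm_gauge Y (z.1.1, z.2.1) - gm_gauge gm_lift (z.1.2, z.2.2)).
  apply: measurable_funB.
    apply: (measurableT_comp (gauge_measurable (gm_gaugeP Y))).
    apply: (@measurable_map2 _ _ (borel (Y * gm_lift)%type) (borel Y) fst).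
    by apply: continuous_borel => z; exact: cvg_fst.
  apply: (measurableT_comp (gauge_measurable (gm_gaugeP gm_lift))).
  apply: (@measurable_map2 _ _ (borel (Y * gm_lift)%type) (borel gm_lift) snd).
  by apply: continuous_borel => z; exact: cvg_snd.
apply: (etrans (esym (@pushes_Lnorm R _ _ _ _ mu _ _ mf (push_probE _ mf) _ mg))).
rewrite (@eq_Lnorm _ _ _ _ _ _ (cst 0%E)) ?Lnorm0// => z.
by rewrite /= subrr.
Qed.

End Lift.

Lemma pushes_to_comp d1 d2 d3 (S : measurableType d1) (T : measurableType d2)
    (U : measurableType d3) (mu : {measure set S -> \bar R})
    (nu : {measure set T -> \bar R}) (la : {measure set U -> \bar R})
    (f : S -> T) (g : T -> U) :
  measurable_fun setT g -> pushes_to mu f nu -> pushes_to nu g la ->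
  pushes_to mu (g \o f) la.
Proof.
move=> mg munu nula A mA; rewrite -nula//; apply: (munu (g @^-1` A)).
by rewrite -[X in measurable X]setTI; exact: mg.
Qed.

Section Residual.
Variables (Y X : gmSpace) (pi : plan Y X).

Let fst_cts : continuous (fst : (Y * X)%type -> Y).
Proof. by move=> z; exact: cvg_fst. Qed.

Let snd_cts : continuous (snd : (Y * X)%type -> X).
Proof. by move=> z; exact: cvg_snd. Qed.

(* (g_X - g_Y) attached to the representative (Y x X, g_Y, pi) of the class of Y *)
Definition residual : tangent (gm_class Y) :=
  Tangent (gm_lift_class (gm_polish X) (plan_fst pi))
    (gaugeB (gauge_comp snd_cts (plan_snd pi) (gm_gaugeP X))
            (gauge_comp fst_cts (plan_fst pi) (gm_gaugeP Y))).

Lemma residualE z : tg_fun residual z =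
  gm_gauge X (z.1.2, z.2.2) - gm_gauge Y (z.1.1, z.2.1).
Proof. by []. Qed.

End Residual.

Section Mean.
Variables (N : nat) (Y : gmSpace) (X : 'I_N -> gmSpace).

Record gluing (pi : forall i, plan Y (X i)) := Gluing {
  gluing_law :> probability (borel (Y * prod_topology X)%type) R ;
  gluing_marg : forall i, pushes_to gluing_law
    ((fun w => (w.1, w.2 i)) :
       borel (Y * prod_topology X)%type -> borel (Y * X i)%type) (pi i) }.

Hypothesis N_gt0 : (0 < N)%N.
Variables (pi : forall i, plan Y (X i)) (gamma : gluing pi) (rho : 'I_N -> R).

Let fst_cts : continuous (fst : (Y * prod_topology X)%type -> Y).
Proof. by move=> z; exact: cvg_fst. Qed.

Let coord_cts i :
  continuous ((fun w => w.2 i) : (Y * prod_topology X)%type -> X i).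
Proof.
move=> z A /(@proj_continuous _ X i z.2) nA.
exact: (@cvg_snd _ _ (nbhs z.1) (nbhs z.2) _ _ nA).
Qed.

Lemma gluing_fst : pushes_to gamma
  (fst : borel (Y * prod_topology X)%type -> borel Y) (gm_law Y).
Proof.
pose i := Ordinal N_gt0.
have mf : measurable_fun setT (fst : borel (Y * X i)%type -> borel _).
  by apply: continuous_borel => z; exact: cvg_fst.
exact: pushes_to_comp mf (@gluing_marg _ gamma i) (plan_fst (pi i)).
Qed.

Lemma gluing_coord i : pushes_to gamma
  ((fun w => w.2 i) : borel (Y * prod_topology X)%type -> borel (X i))
  (gm_law (X i)).
Proof.
have mf : measurable_fun setT (snd : borel (Y * X i)%type -> borel _).
  by apply: continuous_borel => z; exact: cvg_snd.
exact: pushes_to_comp mf (@gluing_marg _ gamma i) (plan_snd (pi i)).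
Qed.

Lemma polish_factors : @polish R (prod_topology X).
Proof.
apply: polish_prod_topology => i; last exact: gm_polish.
exact: (inhabits point).
Qed.

(* (m_rho - g_Y) attached to the representative
   (Y x X_1 x ... x X_N, g_Y, gamma) of the class of Y *)
Definition mean_residual : tangent (gm_class Y) :=
  Tangent (gm_lift_class polish_factors gluing_fst)
    (gaugeB
      (gauge_sum rho (fun i =>
        gauge_comp (@coord_cts i) (@gluing_coord i) (gm_gaugeP (X i))))
      (gauge_comp fst_cts gluing_fst (gm_gaugeP Y))).

Lemma mean_residualE z : tg_fun mean_residual z =
  \sum_(i < N) rho i * gm_gauge (X i) (z.1.2 i, z.2.2 i)
  - gm_gauge Y (z.1.1, z.2.1).
Proof. by []. Qed.

End Mean.

End GaugedSpaces.

Arguments gmSpace : clear implicits.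

(* Main.v *)
From HB Require Import structures.
Require Import Defs.
From mathcomp Require Import all_boot all_order all_algebra.
From mathcomp Require Import all_classical all_reals all_analysis.
From mathcomp Require Import measurable_realfun lra ring.

Set Implicit Arguments.
Unset Strict Implicit.
Unset Printing Implicit Defensive.

Import Order.TTheory GRing.Theory Num.Theory.
Import numFieldNormedType.Exports.

Local Open Scope classical_set_scope.
Local Open Scope ring_scope.

(** Tangents are attached to arbitrary representatives of the class, so a minimising sequence of
    tangents lives on changing Polish spaces. Passing to laws on the one product of the Y_i fixes
    the space and all marginals, and compactness becomes available. The price is that each factor
    keeps its own copy y_i of the point of Y: optimal plans into the base of F identify the values
    of h, not the points. The y_i may therefore differ under an admissible law, which is why plans
    equivalent to the pi_i, and not the pi_i themselves, appear in the result: all x_i are referred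
    to one common copy.

    The gauges are merely measurable, so weak convergence, which tests continuous functions, does
    not control the norms directly. Convergence of the values on all measurable boxes does, because
    the functions in the norms are sums of terms in a single coordinate, whose L2 size is governed
    by the marginals and is hence the same for every competitor. The constraint is itself the
    vanishing of such norms and so survives the limit. Disintegration of plans is avoided:
    conditioning only takes place on finitely many cells. *)

(* Call a law gamma on the product of the spaces Y x X_i admissible if its i-th
   marginal is pi_i and all the copies of h coincide almost surely, and put
   J(gamma) = sum_i rho_i ||g_i - m_rho||^2.  Gluing optimal plans between the
   Y_i and the base of a tangent F along that base yields an admissible gamma
   with J(gamma) <= objective(F), since m_rho minimises
   c |-> sum_i rho_i (g_i - c)^2 pointwise.  Conversely, under an admissible
   gamma the law of (y_1, x_1, ..., x_N) is a gluing of plans equivalent to the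
   pi_i, and the objective at its mean residual is at most J(gamma).  Hence it
   suffices to minimise J over the admissible laws.

   Both the gluing and the existence of a minimiser rest on one fact: a finitely
   additive function on the Borel sets of a finite product of Polish spaces whose
   one-dimensional marginals are probabilities agrees on measurable boxes with
   a probability.  Finitely additive functions arise as ultrafilter limits: of a
   minimising sequence for the minimiser, and of atomic laws attached to finer
   and finer finite partitions for the gluing.  As marginals are fixed and
   rectangle-simple functions are dense in L^2, the norms entering J converge
   along the ultrafilter. *)

(** * Extension of tight finitely additive contents *)

Lemma dependent_function_choice (I : Type) (T : I -> Type)
    (P : forall i, T i -> Prop) :
  (forall i, exists x, P i x) -> exists f : forall i, T i, forall i, P i (f i).
Proof.
by move=> h; exists (fun i => projT1 (cid (h i))) => i; exact: projT2 (cid (h i)).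
Qed.

(* The bounds hold on all sets, measurable or not, so that every value has a
   limit along an ultrafilter. *)
Record prob_content (R : realType) (T : ptopologicalType) := ProbContent {
  content_fun :> set T -> R ;
  content_ge0 : forall A, 0 <= content_fun A ;
  content_le1 : forall A, content_fun A <= 1 ;
  contentT : content_fun setT = 1 ;
  contentU : forall A B : set (borel T), measurable A -> measurable B ->
    A `&` B = set0 -> content_fun (A `|` B) = content_fun A + content_fun B }.

Record tight_content (R : realType) (T : ptopologicalType) := TightContent {
  tight_prob_content :> prob_content R T ;
  content_tight : forall e, 0 < e -> exists K : set T,
    [/\ compact K, closed K & tight_prob_content (~` K) <= e] }.

Section ProbContent.
Context {R : realType} {T : ptopologicalType} (l : prob_content R T).
Implicit Types A B : set T.

Lemma open_borel A : open A -> measurable (A : set (borel T)).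
Proof. exact: sub_sigma_algebra. Qed.

Lemma closed_borel A : closed A -> measurable (A : set (borel T)).
Proof.
move=> cA; rewrite -[A]setCK; apply: measurableC.
by apply: open_borel; rewrite openC.
Qed.

Lemma content0 : l set0 = 0.
Proof.
have := contentU l (@measurable0 _ (borel T)) (@measurable0 _ (borel T)) (setIid _).
by rewrite setUid => /eqP; rewrite -subr_eq subrr eq_sym => /eqP.
Qed.

Lemma contentD A B : measurable (A : set (borel T)) ->
  measurable (B : set (borel T)) -> A `<=` B -> l B = l A + l (B `\` A).
Proof.
move=> mA mB AB; rewrite -contentU//; first by rewrite setDUK.
  exact: measurableD.
by apply/seteqP; split => x // [Ax []].
Qed.

Lemma le_content A B : measurable (A : set (borel T)) ->
  measurable (B : set (borel T)) -> A `<=` B -> l A <= l B.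
Proof. by move=> mA mB AB; rewrite (contentD mA mB AB) lerDl content_ge0. Qed.

Lemma content_subU A B : measurable (A : set (borel T)) ->
  measurable (B : set (borel T)) -> l (A `|` B) <= l A + l B.
Proof.
move=> mA mB; rewrite (@contentD A)//; last exact: measurableU.
rewrite lerD2l; apply: le_content => //; last by move=> x [[]].
by apply: measurableD => //; exact: measurableU.
Qed.

Lemma content_sub_bigsetU (I : Type) (s : seq I) (F : I -> set T) :
  (forall i, measurable (F i : set (borel T))) ->
  l (\big[setU/set0]_(i <- s) F i) <= \sum_(i <- s) l (F i).
Proof.
move=> mF; elim: s => [|i s IH]; first by rewrite !big_nil content0.
rewrite !big_cons; apply: le_trans (content_subU _ _) _ => //.
  by apply: bigsetU_measurable.
by rewrite lerD2l.
Qed.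

End ProbContent.

Section Regular.
Context {R : realType} {T : ptopologicalType} (l : tight_content R T).
Implicit Types A B : set T.

(* The compact-open approximation makes a content countably subadditive on
   regular sets: a countable open cover of a compact set has a finite subcover. *)
Definition regular A := measurable (A : set (borel T)) /\
  forall e, 0 < e -> exists C V, [/\ compact C, closed C, open V, C `<=` A /\ A `<=` V &
    l (V `\` C) <= e].

Lemma regular0 : regular set0.
Proof.
split=> // e e0; exists set0, set0; split => //.
- exact: compact0.
- exact: closed0.
- exact: open0.
- by split.
- by rewrite setDv content0 ltW.
Qed.

Lemma regularU : setU_closed regular.
Proof.
move=> A B [mA rA] [mB rB]; split; first exact: measurableU.
move=> e e0; have e2 : 0 < e / 2 by rewrite divr_gt0.
have [C [V [kC cC oO [CA AO] h]]] := (rA _ e2).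
have [C' [V' [kC' cC' oO' [CB BO'] h']]] := (rB _ e2).
exists (C `|` C'), (V `|` V'); split.
- exact: compactU.
- exact: closedU.
- exact: openU.
- by split; exact: setUSS.
- have mO := open_borel oO; have mO' := open_borel oO'.
  have mC := closed_borel cC; have mC' := closed_borel cC'.
  rewrite (splitr e); apply: le_trans (lerD h h').
  apply: le_trans (content_subU l _ _); [|exact: measurableD|exact: measurableD].
  apply: le_content.
  + by apply: measurableD; exact: measurableU.
  + by apply: measurableU; exact: measurableD.
  + by move=> x [[Ox|Ox] nC]; [left|right]; split => // Cx; apply: nC; [left|right].
Qed.

(** The complement of the outer open set is closed but need not be compact. Tightness repairs this:
    cutting with a compact [K] costs at most the content of its complement. *)
Lemma regularC : setC_closed regular.
Proof.
move=> A [mA rA]; split; first exact: measurableC.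
move=> e e0; have e2 : 0 < e / 2 by rewrite divr_gt0.
have [C [V [kC cC oO [CA AO] h]]] := (rA _ e2).
have [K [kK cK hK]] := content_tight l e2.
have cO : closed (~` V) by rewrite closedC.
exists (K `&` ~` V), (~` C); split.
- exact: compact_closedI.
- exact: closedI.
- by rewrite openC.
- by split => [x [_ nO]|]; [move=> Ax; exact/nO/AO|exact: subsetC].
- have mO := open_borel oO; have mC := closed_borel cC; have mK := closed_borel cK.
  rewrite (splitr e); apply: le_trans (lerD h hK).
  apply: le_trans (content_subU l _ _); [|exact: measurableD|exact: measurableC].
  apply: le_content.
  + apply: measurableD; first exact: measurableC.
    by apply: measurableI => //; exact: measurableC.
  + by apply: measurableU; [exact: measurableD|exact: measurableC].
  + move=> x [nC nKO]; have [Kx|] := pselect (K x); last by right.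
    by left; split => //; apply: contrapT => nO; exact: nKO.
Qed.

End Regular.

(* An alias of T whose measurable sets are the regular ones. *)
Definition regular_algebra {R : realType} {T : ptopologicalType}
  (l : tight_content R T) : Type := T.

HB.instance Definition _ R (T : ptopologicalType) (l : tight_content R T) :=
  Pointed.copy (regular_algebra l) T.
HB.instance Definition _ R (T : ptopologicalType) (l : tight_content R T) :=
  isAlgebraOfSets.Build default_measure_display (regular_algebra l)
    (regular0 l) (@regularU _ _ l) (@regularC _ _ l).

Section Extension.
Context {R : realType} {T : ptopologicalType} (l : tight_content R T).

Definition regular_content (A : set (regular_algebra l)) : \bar R := (l A)%:E.

Let rc_ge0 A : (0 <= regular_content A)%E.
Proof. by rewrite lee_fin content_ge0. Qed.

Let rc_add : measure_function.semi_additive regular_content.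
Proof.
apply/additive2P; first by rewrite /regular_content content0.
move=> A B [mA _] [mB _] AB.
by rewrite /regular_content (contentU l mA mB AB) EFinD.
Qed.

HB.instance Definition _ := isContent.Build _ (regular_algebra l) R
  regular_content rc_ge0 rc_add.

(** Half of [e] pays for a compact subset of [A], the other half, split geometrically, for open
    supersets of the [F n]; compactness then reduces the cover to a finite one. *)
Let rc_sub : measurable_subset_sigma_subadditive regular_content.
Proof.
move=> A F rF rA AF.
apply/lee_addgt0Pr => e e0; have e2 : 0 < e / 2 by rewrite divr_gt0.
have [C [V' [kC cC oV' [CA AO'] h]]] := rA.2 _ e2.
have [mA _] := rA.
have /choice[V HO] : forall n, exists V : set T, [/\ open V, F n `<=` V &
    l V <= l (F n) + e / 2 / (2 ^ n.+1)%:R].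
  move=> n; have en : 0 < e / 2 / (2 ^ n.+1)%:R by rewrite divr_gt0.
  have [C1 [V1 [kC1 cC1 oO1 [CA1 AO1] h1]]] := (rF n).2 _ en.
  exists V1; split => //; have mO1 := open_borel oO1; have mC1 := closed_borel cC1.
  rewrite (contentD l (rF n).1 mO1 AO1) lerD2l; apply: le_trans h1.
  apply: le_content.
  - by apply: measurableD => //; exact: (rF n).1.
  - exact: measurableD.
  - by move=> x [Ox nF]; split => // /CA1.
have mO n : measurable (V n : set (borel T)) by have [oO _ _] := HO n; exact: open_borel.
have : finite_subset_cover [set: nat] V C.
  move: kC; rewrite compact_cover; apply; first by move=> i _; have [] := HO i.
  by move=> x /CA/AF[n _ Fx]; exists n => //; have [_ + _] := HO n; apply.
move=> [D _ CD].
(* The finite index set is enlarged to an initial segment, so that a partial sum of the series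
   bounds the content of [C]. *)
pose N := (\max_(i <- finmap.enum_fset D) i).+1.
have CN : C `<=` \big[setU/set0]_(i <- iota 0 N) V i.
  move=> x /CD[i /= iD Vix]; rewrite -bigcup_seq; exists i; last exact: Vix.
  have : i \in iota 0 N by rewrite mem_iota add0n ltnS; exact: leq_bigmax_seq.
  by [].
have mC := closed_borel cC.
have lC : l C <= \sum_(i <- iota 0 N) l (V i).
  apply: le_trans (content_sub_bigsetU l (iota 0 N) mO).
  by apply: le_content => //; exact: bigsetU_measurable.
have lA : l A <= l C + e / 2.
  rewrite (contentD l mC mA CA) lerD2l; apply: le_trans h.
  have mO'  : measurable (V' `\` C : set (borel T)).
    by apply: measurableD => //; exact: open_borel.
  apply: le_content => //; first exact: measurableD.
  by move=> x [Ax nC]; split => //; exact: AO'.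
have lS : ((\sum_(i <- iota 0 N) l (V i))%:E <=
    \sum_(0 <= i <oo) (regular_content (F i) + (e / 2 / (2 ^ i.+1)%:R)%:E))%E.
  apply: (@le_trans _ _ (\sum_(0 <= i < N)
      (regular_content (F i) + (e / 2 / (2 ^ i.+1)%:R)%:E))%E).
    rewrite /index_iota subn0 -sumEFin; apply: lee_sum => i _.
    by rewrite /regular_content -EFinD lee_fin; have [] := HO i.
  apply: nneseries_lim_ge => i _ _; apply: adde_ge0 => //.
  by rewrite lee_fin divr_ge0// ltW.
have Hs : ((l C)%:E <= \sum_(0 <= i <oo) regular_content (F i) + (e / 2)%:E)%E.
  apply: le_trans (epsilon_trick _ _ (ltW e2)); last by move=> n; exact: rc_ge0.
  by apply: le_trans lS; rewrite lee_fin.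
rewrite [X in (_ + X%:E)%E]splitr EFinD addeA.
apply: le_trans (leeD2r _ Hs).
by rewrite -EFinD lee_fin.
Qed.

HB.instance Definition _ := Content_SigmaSubAdditive_isMeasure.Build _ R
  (regular_algebra l) regular_content rc_sub.

(** The measure extension lives on the sigma-algebra generated by the regular sets. By hypothesis
    this contains the open sets, so the identity into [borel T] is measurable and pushes the
    extension to a Borel law. *)
Lemma tight_content_extension :
  (forall A, open A -> <<s regular l >> A) ->
  exists mu : probability (borel T) R, forall A, regular l A -> mu A = (l A)%:E.
Proof.
move=> gen.
pose S := g_sigma_algebraType (@measurable _ (regular_algebra l)).
pose m : {measure set S -> \bar R} := measure_extension regular_content.
have mid : measurable_fun setT (idfun : S -> borel T).
  apply: (@measurability _ _ S (borel T) setT idfun (@open T) erefl) => _ [A oA <-].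
  by rewrite setTI; exact: gen.
have mE A : regular l A -> m A = (l A)%:E.
  by move=> rA; rewrite /m /= /measure_extension measurable_mu_extE.
have rT : regular l setT by rewrite -setC0; apply: regularC; exact: regular0.
have m1 : m setT = 1%E by rewrite (mE _ rT) contentT.
pose P : probability S R :=
  HB.pack (Measure.sort m) (Measure_isProbability.Build _ S R m m1).
exists (push_prob P mid) => A rA; rewrite -mE//.
Qed.

End Extension.

(** * Regularity of laws on Polish spaces *)

Section PolishLaw.
Context {R : realType} {T : ptopologicalType}.
Variable xi : probability (borel T) R.

Lemma vanishing_measure d (S : measurableType d) (mu : probability S R)
    (F : nat -> set S) (e : R) : 0 < e ->
  (forall n, measurable (F n)) -> (forall n m, (n <= m)%N -> F m `<=` F n) ->
  \bigcap_n F n = set0 -> exists n, (mu (F n) <= e%:E)%E.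
Proof.
move=> e0 mF nF F0.
have : (mu \o F) n @[n --> \oo] --> mu (\bigcap_n F n).
  apply: nonincreasing_cvg_mu => //.
  - by rewrite (le_lt_trans (probability_le1 mu (mF 0%N)))// ltry.
  - by rewrite F0.
  - by move=> n m nm; apply/subsetPset/nF.
rewrite F0 measure0 => h.
have [n _ /(_ n (leqnn n)) /=] : \forall n \near \oo, (mu (F n) < e%:E)%E.
  by apply: (h [set x | (x < e%:E)%E]); apply: open_nbhs_nbhs; split;
    [exact: open_ereal_lt_ereal|rewrite /= lte_fin].
by move=> /ltW; exists n.
Qed.

Lemma measure_bigcup_geometric d (S : measurableType d) (mu : probability S R)
    (F : nat -> set S) (e : R) : 0 <= e -> (forall k, measurable (F k)) ->
  (forall k, (mu (F k) <= (e / (2 ^ k.+1)%:R)%:E)%E) ->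
  (mu (\bigcup_k F k) <= e%:E)%E.
Proof.
move=> e0 mF h; have mU := bigcupT_measurable F mF.
apply: le_trans
  (@measure_sigma_subadditive _ _ _ mu _ F mF mU (@subset_refl _ _)) _.
have := @epsilon_trick R (fun=> 0%E) e xpredT (fun=> lexx _) e0.
rewrite [X in (_ <= X + _)%E]eseries0// add0e; apply: le_trans.
by apply: lee_nneseries => // k _; rewrite add0e; exact: h.
Qed.

Lemma invS_lt (e : R) : 0 < e -> exists k, k.+1%:R^-1 < e.
Proof.
by move=> e0; have [k _ /(_ k (leqnn k))] := near_infty_natSinv_lt (PosNum e0); exists k.
Qed.

(** With closed inner sets in place of compact ones, complementation just exchanges the two
    approximations, without tightness. Compactness is recovered later by intersecting with a compact
    set of almost full mass. *)
Definition sandwiched (A : set T) := measurable (A : set (borel T)) /\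
  forall e : R, 0 < e -> exists C V, [/\ closed C, open V, C `<=` A, A `<=` V &
    (xi (V `\` C) <= e%:E)%E].

Lemma sandwichedC A : sandwiched A -> sandwiched (~` A).
Proof.
move=> [mA sA]; split; first exact: measurableC.
move=> e /sA[C [V [cC oV CA AV h]]].
exists (~` V), (~` C); split.
- by rewrite closedC.
- by rewrite openC.
- exact: subsetC.
- exact: subsetC.
- by rewrite setDE setCK setIC -setDE.
Qed.

Lemma sandwiched_bigcup (F : nat -> set T) :
  (forall n, sandwiched (F n)) -> sandwiched (\bigcup_n F n).
Proof.
move=> sF; split; first by apply: bigcupT_measurable => n; have [] := sF n.
move=> e e0; have e2 : 0 < e / 2 by rewrite divr_gt0.
have /choice[CV HCV] : forall n, exists CV : set T * set T,
    [/\ closed CV.1, open CV.2, CV.1 `<=` F n, F n `<=` CV.2 &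
      (xi (CV.2 `\` CV.1) <= (e / 2 / (2 ^ n.+1)%:R)%:E)%E].
  move=> n; have en : 0 < e / 2 / (2 ^ n.+1)%:R by rewrite divr_gt0.
  by have [C [V h]] := (sF n).2 _ en; exists (C, V).
pose C n := (CV n).1; pose V n := (CV n).2.
have cC n : closed (C n) by have [] := HCV n.
have oV n : open (V n) by have [] := HCV n.
have mC n : measurable (C n : set (borel T)) by exact: closed_borel.
have mV n : measurable (V n : set (borel T)) by exact: open_borel.
pose D n := \big[setU/set0]_(i < n) C i.
have mD n : measurable (D n : set (borel T)) by exact: bigsetU_measurable.
(* The union of all [C n] need not be closed; a finite part of it carries all but [e / 2] of its
   mass. *)
have [N hN] : exists n, (xi ((\bigcup_n C n) `\` D n) <= (e / 2)%:E)%E.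
  apply: vanishing_measure => //.
  - by move=> n; apply: measurableD => //; exact: bigcupT_measurable.
  - move=> n m nm x [Cx nD]; split => // Dx; apply: nD.
    move: Dx; rewrite /D -!bigcup_mkord => -[i /= im Ci]; exists i => //=.
    exact: leq_trans nm.
  - rewrite -subset0 => x h; have [[i _ Ci] _] := h 0%N Logic.I.
    have [_] := h i.+1 Logic.I; apply.
    by rewrite /D -bigcup_mkord; exists i => //=.
exists (D N), (\bigcup_n V n); split.
- by rewrite /D -bigcup_mkord; apply: closed_bigcup => //; exact: finite_II.
- exact: bigcup_open.
- move=> x; rewrite /D -bigcup_mkord => -[i _ Ci]; exists i => //.
  by have [_ _ + _ _] := HCV i; apply.
- move=> x [i _ Fi]; exists i => //.
  by have [_ _ _ + _] := HCV i; apply.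
have hV : (xi (\bigcup_n (V n `\` C n)) <= (e / 2)%:E)%E.
  apply: measure_bigcup_geometric; first exact: ltW.
    by move=> n; exact: measurableD.
  by move=> n; have [] := HCV n.
rewrite (splitr e) EFinD.
apply: le_trans (leeD hV hN).
apply: le_trans (measureU2 _ _ _).
- apply: le_measure; [apply: mem_set|apply: mem_set|].
  + by apply: measurableD => //; exact: bigcupT_measurable.
  + apply: measurableU; first by apply: bigcupT_measurable => n; exact: measurableD.
    by apply: measurableD => //; exact: bigcupT_measurable.
  + move=> x [[i _ Vi] nD]; have [[j _ Cj]|nC] := pselect ((\bigcup_n C n) x).
      by right; split => //; exists j.
    by left; exists i => //; split => // Ci; apply: nC; exists i.
- by apply: bigcupT_measurable => n; exact: measurableD.
- by apply: measurableD => //; exact: bigcupT_measurable.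
Qed.

Hypothesis pT : @polish R T.

Lemma polish_dense_seq : exists d : T -> T -> R,
  [/\ is_metric d, metrizes d & complete_metric d] /\
  exists q : nat -> T, forall x e, 0 < e -> exists j, d (q j) x < e.
Proof.
have [[D cD dD] [d [dm dM dc]]] := pT; exists d; split => //.
have ds : forall x y, d x y = d y x by case: dm.
have nbd x e : 0 < e -> nbhs x [set y | d x y < e] by move=> e0; apply/dM; exists e.
have Dne x e : 0 < e -> exists2 y, D y & d x y < e.
  move=> e0; have : [set y | d x y < e]° `&` D !=set0.
    by apply: dD; [exists x; exact: nbd|exact: open_interior].
  by move=> [y [/interior_subset/= xy Dy]]; exists y.
(* [D] is nonempty, so it can be enumerated by the whole of [nat]. *)
have [p Dp _] := Dne point 1 ltr01.
have /pfcard_geP[D0|[f]] := cD; first by rewrite D0 in Dp.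
exists f => x e /(Dne x)[y Dy xy].
have : range f y by rewrite image_eq.
by move=> [n _ ny]; exists n; rewrite ds ny.
Qed.

(** The sandwiched sets form a sigma-algebra; it contains the open sets because in a metric space
    these are increasing unions of closed sets. *)
Lemma sandwiched_measurable (A : set (borel T)) : measurable A -> sandwiched A.
Proof.
have [d [[[d0 ds dt] dM dc] _]] := polish_dense_seq.
have oball x e : open [set y | d x y < e].
  rewrite openE => y /= xy; apply/dM; exists (e - d x y); first by rewrite subr_gt0.
  by move=> z /=; rewrite ltrBrDl; apply: le_lt_trans; exact: dt.
apply: smallest_sub; first split.
- split; first exact: measurable0.
  move=> e e0; exists set0, set0; split => //; [exact: closed0|exact: open0|].
  by rewrite setDv measure0 lee_fin ltW.
- by move=> B sB; rewrite setTD; exact: sandwichedC.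
- exact: sandwiched_bigcup.
move=> V oV; split; first exact: open_borel.
move=> e e0.
(* The points at distance at least [n.+1%:R^-1] from the complement of [V]. *)
pose C n := [set x | forall y, d x y < n.+1%:R^-1 -> V y].
have cC n : closed (C n).
  rewrite -[C n]setCK closedC.
  have -> : ~` C n = \bigcup_(y in ~` V) [set x | d y x < n.+1%:R^-1].
    apply/seteqP; split => x /=.
      by move=> /existsNP[y /not_implyP[xy nV]]; exists y => //=; rewrite ds.
    by move=> [y nV /= yx] h; apply/nV/h; rewrite ds.
  by apply: bigcup_open => y _; exact: oball.
have [n hn] : exists n, (xi (V `\` C n) <= e%:E)%E.
  apply: vanishing_measure => //.
  - by move=> n; apply: measurableD; [exact: open_borel|exact: closed_borel].
  - move=> n m nm x [Vx nC]; split => // Cx; apply: nC => y xy; apply: Cx.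
    by apply: lt_le_trans xy _; rewrite lef_pV2 ?posrE// ler_nat.
  - rewrite -subset0 => x h; have [Vx _] := h 0%N Logic.I.
    have /dM[r r0 rV] : nbhs x V by apply: open_nbhs_nbhs.
    have [n hn] := invS_lt r0.
    have [_] := h n Logic.I; apply => y xy; apply: rV => /=.
    exact: lt_trans xy hn.
exists (C n), V; split => //.
by move=> x /(_ x); apply; rewrite (d0 x x).2.
Qed.

(** Ulam's argument: at every scale finitely many closed balls around the dense sequence carry
    almost all the mass. The intersection over all scales is closed and totally bounded, hence
    compact by completeness. *)
Lemma polish_law_tight (e : R) : 0 < e ->
  exists K : set T, [/\ compact K, closed K & (xi (~` K) <= e%:E)%E].
Proof.
move=> e0.
have [d [[[d0 ds dt] dM dc] [q dq]]] := polish_dense_seq.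
have oball x (r : R) : open [set y | d x y < r].
  rewrite openE => y /= xy; apply/dM; exists (r - d x y); first by rewrite subr_gt0.
  by move=> z /=; rewrite ltrBrDl; apply: le_lt_trans; exact: dt.
pose B k j := ~` [set y | k.+1%:R^-1 < d (q j) y].
have cB k j : closed (B k j).
  rewrite closedC openE => y /= xy; apply/dM.
  exists (d (q j) y - k.+1%:R^-1); first by rewrite subr_gt0.
  move=> z /= yz; rewrite -(ltrD2r (d z y)).
  apply: lt_le_trans (dt z _ _).
  by move: yz; rewrite (ds y z) ltrBrDl addrC.
have mB k j : measurable (B k j : set (borel T)) by exact: closed_borel.
pose E k n := \big[setU/set0]_(j < n) B k j.
have cE k n : closed (E k n) by apply: closed_bigsetU.
have mE k n : measurable (E k n : set (borel T)) by exact: closed_borel.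
have /choice[n hn] : forall k, exists n, (xi (~` E k n) <= (e / (2 ^ k.+1)%:R)%:E)%E.
  move=> k; apply: vanishing_measure; first by rewrite divr_gt0.
  - by move=> n; exact: measurableC.
  - move=> i j ij; apply: subsetC; rewrite /E -!bigcup_mkord => x [a /= ai Ba].
    by exists a => //=; exact: leq_trans ij.
  - rewrite -subset0 => x h.
    have [j hj] := dq x k.+1%:R^-1 (ltac:(by rewrite invr_gt0)).
    apply: (h j.+1 Logic.I); rewrite /E -bigcup_mkord; exists j => //=.
    by apply/negP; rewrite -leNgt ltW.
exists (\bigcap_k E k (n k)); split.
- rewrite compact_ultra => F FU FK.
  have FF : ProperFilter F by exact: ultra_proper.
  have FE k : F (E k (n k)) by apply: filterS FK => x; apply.
  (* An ultrafilter containing a finite union contains one of its members, so it selects a ball at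
     each scale. *)
  have /choice[j hj] : forall k, exists j, F (B k j).
    move=> k; apply: contrapT => /forallNP nF.
    have : forall m, F (~` E k m).
      elim=> [|m IH]; first by rewrite /E big_ord0 setC0; exact: filterT.
      rewrite /E big_ord_recr /= setCU; apply: filterI => //.
      by have [/nF|] := in_ultra_setVsetC (B k m) FU.
    move=> /(_ (n k)) h; have := @filterI _ F FF _ _ h (FE k).
    by rewrite setICl => F0; exact: (@filter_not_empty _ F FF F0).
  pose D k := \bigcap_(i < k) B i (j i).
  have FD k : F (D k).
    elim: k => [|k IH].
      by apply: filterS filterT => x _ i.
    apply: filterS (filterI IH (hj k)) => x [Dx Bx] i /=.
    by rewrite ltnS leq_eqVlt => /orP[/eqP->//|/Dx].
  have /choice[u hu] : forall k, exists x, D k x.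
    by move=> k; exact: filter_ex (FD k).
  have uB k m : (k < m)%N -> d (q (j k)) (u m) <= k.+1%:R^-1.
    by move=> km; have /negP := hu m k km; rewrite -leNgt.
  (* Points taken from the finite intersections of the selected balls form a Cauchy sequence; as the
     radii shrink, its limit is also the limit of the ultrafilter. *)
  have [x ux] : exists l : T, u @ \oo --> l.
    apply: dc => r r0; have r2 : 0 < r / 2 by rewrite divr_gt0.
    have [k hk] := invS_lt r2.
    exists k.+1 => a b ka kb.
    rewrite (splitr r); apply: le_lt_trans (dt (q (j k)) _ _) _.
    by rewrite ltrD//; [rewrite ds|]; apply: le_lt_trans (uB _ _ _) hk.
  have Fx : F --> x.
    move=> A /dM[r r0 rA].
    have r3 : 0 < r / 3%:R by rewrite divr_gt0.
    have [k hk] := invS_lt r3.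
    have [m _ hm] : \forall m \near \oo, d x (u m) < r / 3%:R.
      by move/(cvg_metric _ _ dM): ux; apply.
    pose m' := maxn m k.+1.
    have xm : d x (u m') < r / 3%:R by apply: hm; rewrite /= leq_max leqnn.
    have qm : d (q (j k)) (u m') < r / 3%:R.
      by apply: le_lt_trans (uB _ _ _) hk; rewrite leq_max leqnn orbT.
    apply: filterS (hj k) => y /negP; rewrite -leNgt => qy; apply: rA => /=.
    apply: le_lt_trans (dt (u m') _ _) _.
    apply: (@lt_le_trans _ _ (r / 3%:R + (r / 3%:R + r / 3%:R))); last by lra.
    apply: ltrD => //; apply: le_lt_trans (dt (q (j k)) _ _) _.
    by rewrite ltrD//; [rewrite ds|exact: le_lt_trans hk].
  exists x; split => // k _.
  by apply: cE => A /Fx FA; exact: filter_ex (filterI (FE k) FA).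
- by apply: closed_bigI => k _.
- rewrite setC_bigcap; apply: measure_bigcup_geometric; first exact: ltW.
    by move=> k; exact: measurableC.
  exact: hn.
Qed.

Lemma polish_law_regular (A : set (borel T)) (e : R) : measurable A -> 0 < e ->
  exists C V, [/\ compact (C : set T), closed (C : set T), open (V : set T),
    C `<=` A /\ A `<=` V & (xi (V `\` C) <= e%:E)%E].
Proof.
move=> mA e0; have e2 : 0 < e / 2 by rewrite divr_gt0.
have [_ /(_ _ e2)[C [V [cC oV CA AV h]]]] := sandwiched_measurable mA.
have [K [kK cK hK]] := polish_law_tight e2.
exists (C `&` K), V; split => //.
- by rewrite setIC; exact: compact_closedI.
- exact: closedI.
- by split=> // x [/CA].
have mC := closed_borel cC; have mK := closed_borel cK; have mV := open_borel oV.
rewrite (splitr e) EFinD.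
apply: le_trans (leeD h hK).
apply: le_trans (measureU2 _ _ _); [|exact: measurableD|exact: measurableC].
apply: le_measure; [apply: mem_set|apply: mem_set|].
- by apply: measurableD => //; exact: measurableI.
- by apply: measurableU; [exact: measurableD|exact: measurableC].
- move=> x [Vx nCK]; have [Kx|] := pselect (K x); last by right.
  by left; split => // Cx; apply: nCK.
Qed.

End PolishLaw.

(** * Borel sets and contents on finite products *)

Section Base.
Context {R : realType}.

Lemma polish_base (T : ptopologicalType) : @polish R T ->
  exists b : nat -> set T, (forall n, open (b n)) /\
    forall x A, nbhs x A -> exists n, b n x /\ b n `<=` A.
Proof.
move=> /polish_dense_seq[d [[[d0 ds dt] dM _] [q dq]]].
have oball x (r : R) : open [set y | d x y < r].
  rewrite openE => y /= xy; apply/dM; exists (r - d x y); first by rewrite subr_gt0.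
  by move=> z /=; rewrite ltrBrDl; apply: le_lt_trans; exact: dt.
pose c (jk : nat * nat) := [set y | d (q jk.1) y < jk.2.+1%:R^-1].
exists (fun n => c (odflt (0, 0)%N (unpickle n))); split.
  by move=> n; exact: oball.
move=> x A /dM[e e0 eA].
have e2 : 0 < e / 2 by rewrite divr_gt0.
have [k hk] := invS_lt e2.
have [j hj] := dq x k.+1%:R^-1 (ltac:(by rewrite invr_gt0)).
exists (pickle (j, k)); rewrite pickleK /=; split => // y qy; apply: eA => /=.
rewrite (splitr e); apply: le_lt_trans (dt (q j) _ _) _.
by rewrite ltrD//; [rewrite ds|]; apply: lt_trans hk.
Qed.

End Base.

(** An open set is the union of the basic sets inside it. Indexing by codes, with [set0] for those
    not inside, makes this a union over [nat]. *)
Lemma open_in_sigma (T : topologicalType) (I : countType) (b : I -> set T)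
    (G : set (set T)) :
  (forall x A, nbhs x A -> exists i, b i x /\ b i `<=` A) ->
  (forall i, G (b i)) -> forall V, open V -> <<s G >> V.
Proof.
move=> hb Gb V oV.
have [s0 sC sU] := smallest_sigma_algebra setT G.
pose F n := if unpickle n is Some i then if `[< b i `<=` V >] then b i else set0
  else set0.
have -> : V = \bigcup_n F n.
  apply/seteqP; split => x.
    move=> Vx; have [i [bx bV]] := hb x V (ltac:(exact: open_nbhs_nbhs)).
    by exists (pickle i) => //; rewrite /F pickleK asboolT.
  by move=> [n _]; rewrite /F; case: unpickle => // i; case: asboolP => // + ?; apply.
apply: sU => n; rewrite /F; case: unpickle => // i; case: asboolP => // _.
exact: sub_gen_smallest.
Qed.

Lemma borel_setX (X Y : ptopologicalType) (A : set (borel X)) (B : set (borel Y)) :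
  measurable A -> measurable B -> measurable (A `*` B : set (borel (X * Y)%type)).
Proof.
move=> mA mB; rewrite -[_ `*` _](_ : fst @^-1` A `&` snd @^-1` B = _)//.
have mf : measurable_fun setT (fst : borel (X * Y)%type -> borel X).
  by apply: continuous_borel => u; exact: cvg_fst.
have ms : measurable_fun setT (snd : borel (X * Y)%type -> borel Y).
  by apply: continuous_borel => u; exact: cvg_snd.
by apply: measurableI; rewrite -[X in measurable X]setTI; [exact: mf|exact: ms].
Qed.

(** The Borel sets here come from the product topology. By second countability they are generated by
    the measurable rectangles, which are stable under intersection, so uniqueness of measures
    applies. *)
Lemma borel_pair_eq (R : realType) (X Y : ptopologicalType)
    (mu nu : probability (borel (X * Y)%type) R) :
  @polish R X -> @polish R Y ->
  (forall (A : set (borel X)) (B : set (borel Y)), measurable A -> measurable B ->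
    mu (A `*` B) = nu (A `*` B)) ->
  forall A, measurable A -> mu A = nu A.
Proof.
move=> /polish_base[b [ob hb]] /polish_base[c [oc hc]] E A mA.
pose G : set (set (borel (X * Y)%type)) :=
  [set C | exists A B, [/\ measurable (A : set (borel X)),
    measurable (B : set (borel Y)) & C = A `*` B]].
have mG : measurable = <<s G >>.
  apply/seteqP; split.
    apply: smallest_sub; first exact: smallest_sigma_algebra.
    apply: (@open_in_sigma _ (nat * nat)%type (fun ij => b ij.1 `*` c ij.2)).
      move=> [x y] V [[P Q] /= [/hb[i [bx bP]] /hc[j [cy cQ]] PQV]].
      exists (i, j); split => //= z [? ?]; apply: PQV; split; [exact: bP|exact: cQ].
    move=> [i j] /=; exists (b i), (c j); split => //; exact: open_borel.
  apply: smallest_sub; first exact: sigma_algebra_measurable.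
  move=> _ [P [Q [mP mQ ->]]].
  exact: borel_setX.
apply: (@measure_unique _ _ _ G (fun=> setT) mG) => //.
- move=> _ _ [P [Q [mP mQ ->]]] [P' [Q' [mP' mQ' ->]]].
  exists (P `&` P'), (Q `&` Q'); split; [exact: measurableI..|].
  by apply/seteqP; split => -[x y] /= [[? ?] [? ?]].
- by move=> _; exists setT, setT; split => //; apply/seteqP; split.
- by rewrite bigcup_const.
- by move=> _ [P [Q [mP mQ ->]]]; exact: E.
- by move=> _ /=; rewrite probability_setT ltry.
Qed.

Section ProductExtension.
Context {R : realType} {J : finType} (T : J -> ptopologicalType).
Hypothesis pT : forall j, @polish R (T j).
Variable xi : forall j, probability (borel (T j)) R.

Definition box (A : forall j, set (T j)) : set (prod_topology T) :=
  [set f | forall j, A j (f j)].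

Let pr j : prod_topology T -> T j := fun f => f j.

Lemma pr_continuous j : continuous (fun f : prod_topology T => f j).
Proof. exact: (@proj_continuous _ T j). Qed.

Lemma boxE A : box A = \big[setI/setT]_(j <- enum J) (pr j @^-1` A j).
Proof.
rewrite -bigcap_seq; apply/seteqP; split => f Af j; first by move=> _; exact: Af.
by apply: Af => /=; rewrite mem_enum.
Qed.

Lemma box_borel (A : forall j, set (borel (T j))) :
  (forall j, measurable (A j)) -> measurable (box A : set (borel (prod_topology T))).
Proof.
move=> mA; rewrite boxE; apply: bigsetI_measurable => j _.
rewrite -[X in measurable X]setTI.
exact: (continuous_borel (@pr_continuous j)).
Qed.

Lemma box_open A : (forall j, open (A j)) -> open (box A).
Proof.
move=> oA; rewrite boxE; elim/big_ind: _ => [|U V|]; [exact: openT|exact: openI|].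
by move=> j _; apply: open_comp => // f _; exact: pr_continuous.
Qed.

Lemma box_closed A : (forall j, closed (A j)) -> closed (box A).
Proof.
move=> cA; rewrite boxE; elim/big_ind: _ => //; first exact: closedI.
by move=> j _; apply: closed_comp => // f _; exact: pr_continuous.
Qed.

(** The sets containing a box of neighbourhoods form a filter that converges to [f] in each
    coordinate, hence in the product topology, the supremum of the initial topologies of the
    projections. *)
Lemma box_nbhs (f : prod_topology T) (A : set (prod_topology T)) : nbhs f A ->
  exists B : forall j, set (T j), (forall j, nbhs (f j) (B j)) /\ box B `<=` A.
Proof.
pose F : set_system (prod_topology T) :=
  [set A | exists B : forall j, set (T j), (forall j, nbhs (f j) (B j)) /\ box B `<=` A].
have FF : Filter F.
  split.
  - by exists (fun=> setT); split => // j; exact: filterT.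
  - move=> P Q [B [nB BP]] [C [nC CQ]]; exists (fun j => B j `&` C j); split.
      by move=> j; exact: filterI.
    by move=> g h; split; [apply: BP|apply: CQ] => j; have [] := h j.
  - by move=> P Q PQ [B [nB BP]]; exists B; split => // g /BP/PQ.
have : F --> f.
  apply/cvg_sup => i B.
  have -> := @nbhsE (initial_topology (fun f : (forall i, T i) => f i)) f.
  move=> [C [[V oV VC] Cx] CB].
  have nV : nbhs (f i) V by apply: open_nbhs_nbhs; split => //; rewrite -VC in Cx.
  (* V in coordinate i and no constraint elsewhere, without casting along j = i *)
  exists (fun j => [set x | forall y, Tagged T x = Tagged T y :> {j & T j} -> V y]).
  split=> [j|g /(_ i) /= gV]; last by apply: CB; rewrite -VC; exact: gV.
  have [ji|ji] := eqVneq j i; last first.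
    apply: (@filterS _ (nbhs (f j)) _ setT); last exact: filterT.
    move=> x _ y e.
    by have /= ij := congr1 (fun u : {j & T j} => tag u) e; rewrite ij eqxx in ji.
  by rewrite ji; apply: filterS nV => x Vx y e; rewrite -(eq_from_Tagged e).
by apply.
Qed.

(** As [J] is finite, boxes of basic sets form a countable base, indexed by [{ffun J -> nat}]. *)
Lemma prod_open_generated (G : set (set (prod_topology T))) :
  (forall A : forall j, set (T j), (forall j, open (A j)) -> G (box A)) ->
  forall V, open V -> <<s G >> V.
Proof.
move=> GA.
have /dependent_function_choice[b hb] : forall j,
    exists b : nat -> set (T j), (forall n, open (b n)) /\
    forall x A, nbhs x A -> exists n, b n x /\ b n `<=` A.
  by move=> j; exact: polish_base.
apply: (@open_in_sigma _ {ffun J -> nat} (fun n => box (fun j => b j (n j)))).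
  move=> f A /box_nbhs[B [nB BA]].
  have /dependent_function_choice[n hn] : forall j,
      exists n, b j n (f j) /\ b j n `<=` B j.
    by move=> j; apply: (hb j).2.
  exists [ffun j => n j]; split=> [j|g gb]; first by rewrite ffunE; exact: (hn j).1.
  by apply: BA => j; apply: (hn j).2; have := gb j; rewrite ffunE.
by move=> n; apply: GA => j; exact: (hb j).1.
Qed.

Section Content.
Variable l : prob_content R (prod_topology T).
Hypothesis lxi : forall j (A : set (borel (T j))), measurable A ->
  (l (pr j @^-1` A))%:E = xi j A.

(** The difference of the boxes is covered by the cylinders over the [B j] minus [A j], so marginal
    errors alone control it. The successor in [#|J|.+1] keeps the divisor positive for empty [J]. *)
Let le_box (A B : forall j, set (borel (T j))) (e : R) :
  0 < e -> (forall j, measurable (A j)) -> (forall j, measurable (B j)) ->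
  (forall j, (xi j (B j `\` A j) <= (e / #|J|.+1%:R)%:E)%E) ->
  l (box B `\` box A) <= e.
Proof.
move=> e0 mA mB h.
have mD j : measurable (pr j @^-1` (B j `\` A j) : set (borel (prod_topology T))).
  rewrite -[X in measurable X]setTI.
  by apply: (continuous_borel (@pr_continuous j)) => //; exact: measurableD.
have hs : \sum_(j <- enum J) l (pr j @^-1` (B j `\` A j)) <= e.
  apply: (@le_trans _ _ (\sum_(j <- enum J) e / #|J|.+1%:R)).
    by apply: ler_sum => j _; rewrite -lee_fin lxi; [exact: h|exact: measurableD].
  rewrite big_enum sumr_const -(mulr_natr (e / _)) -mulrA ger_pMr//.
  by rewrite mulrC ler_pdivrMr// mul1r ler_nat.
apply: le_trans hs; apply: le_trans (content_sub_bigsetU l (enum J) mD).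
apply: le_content => //.
- by apply: measurableD; exact: box_borel.
- exact: bigsetU_measurable.
- move=> f [Bf nA]; rewrite -bigcup_seq; apply: contrapT => nE; apply: nA => j.
  apply: contrapT => nAj; apply: nE; exists j; first by rewrite /= mem_enum.
  by split => //; exact: Bf.
Qed.

Let l_tight (e : R) : 0 < e -> exists K : set (prod_topology T),
  [/\ compact K, closed K & l (~` K) <= e].
Proof.
move=> e0; have e1 : 0 < e / #|J|.+1%:R by rewrite divr_gt0.
have /dependent_function_choice[K hK] : forall j, exists K : set (T j),
    [/\ compact K, closed K & (xi j (~` K) <= (e / #|J|.+1%:R)%:E)%E].
  by move=> j; exact: polish_law_tight.
exists (box K); split.
- by apply: tychonoff => j; have [] := hK j.
- by apply: box_closed => j; have [] := hK j.
have -> : ~` box K = box (fun=> setT) `\` box K.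
  by rewrite -setTD; congr (_ `\` _); apply/seteqP; split.
apply: le_box => // j; first by have [_ /closed_borel] := hK j.
by rewrite setTD; have [] := hK j.
Qed.

(** By [le_box], tightness and the regularity of boxes are inherited from the one-dimensional laws,
    so [l] itself may be merely finitely additive. Boxes with open sides then generate the Borel
    sets. *)
Lemma box_content_extension : exists mu : probability (borel (prod_topology T)) R,
  forall A : forall j, set (borel (T j)), (forall j, measurable (A j)) ->
    mu (box A) = (l (box A))%:E.
Proof.
pose lt := TightContent l_tight.
have rbox (A : forall j, set (borel (T j))) : (forall j, measurable (A j)) ->
    regular lt (box A).
  move=> mA; split; first exact: box_borel.
  move=> e e0; have e1 : 0 < e / #|J|.+1%:R by rewrite divr_gt0.
  have /dependent_function_choice[CV h] : forall j, exists CV : set (T j) * set (T j),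
      [/\ compact CV.1, closed CV.1, open CV.2, CV.1 `<=` A j /\ A j `<=` CV.2 &
         (xi j (CV.2 `\` CV.1) <= (e / #|J|.+1%:R)%:E)%E].
    move=> j; have [C [V hj]] := polish_law_regular (xi j) (pT j) (mA j) e1.
    by exists (C, V).
  exists (box (fun j => (CV j).1)), (box (fun j => (CV j).2)); split.
  - by apply: tychonoff => j; have [] := h j.
  - by apply: box_closed => j; have [] := h j.
  - by apply: box_open => j; have [] := h j.
  - split=> f Af j; have [_ _ _ [CA AV] _] := h j; [apply: CA|apply: AV]; exact: Af.
  apply: le_box => // j; have [_ cC oV _ hx] := h j => //.
  - exact: closed_borel.
  - exact: open_borel.
have [|mu hmu] := @tight_content_extension _ _ lt.
  apply: prod_open_generated => A oA.
  by apply: rbox => j; exact: open_borel.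
by exists mu => A mA; apply: hmu; exact: rbox.
Qed.

End Content.
End ProductExtension.

(** * Ultrafilter limits and gluing *)

Section UltraLimit.
Context {R : realType} {I : Type} (U : set_system I) {UU : UltraFilter U}.

(** The values lie in a compact segment, where the image ultrafilter has a cluster point; for an
    ultrafilter a cluster point is a limit. *)
Lemma ultra_cvg (f : I -> R) (a b : R) :
  (forall i, a <= f i <= b) -> f @ U --> lim (f @ U).
Proof.
move=> fab; have UP : ProperFilter U by exact: ultra_proper.
have [p [_ clp]] : `[a, b] `&` cluster (f @ U) !=set0.
  apply: segment_compact; apply: (@filterS _ U _ setT); last exact: filterT.
  by move=> i _; rewrite /= in_itv /= fab.
suff fp : f @ U --> p by rewrite (cvg_lim _ fp).
move=> B nB; have [//|UnB] := in_ultra_setVsetC (f @^-1` B) UU.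
by have [x [nBx Bx]] := clp (~` B) B UnB nB.
Qed.

Lemma ultra_lim_eq (f : I -> R) (a : R) : U [set i | f i = a] -> lim (f @ U) = a.
Proof.
move=> Ua; have UP : ProperFilter U by exact: ultra_proper.
apply: cvg_lim => //; apply: cvg_near_cst.
exact: filterS Ua.
Qed.

Context {T : ptopologicalType} (c : I -> prob_content R T).

Let c01 A i : 0 <= c i A <= 1.
Proof. by rewrite content_ge0 content_le1. Qed.

Let l A := lim ((fun i => c i A) @ U).

Let UP : ProperFilter U := @ultra_proper _ _ UU.

Let l_ge0 A : 0 <= l A.
Proof.
apply: limr_ge; first by apply: cvgP; exact: ultra_cvg (c01 A).
by apply: nearW => i; exact: content_ge0.
Qed.

Let l_le1 A : l A <= 1.
Proof.
apply: limr_le; first by apply: cvgP; exact: ultra_cvg (c01 A).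
by apply: nearW => i; exact: content_le1.
Qed.

Let lT : l setT = 1.
Proof.
apply: ultra_lim_eq; apply: (@filterS _ U _ setT); last exact: filterT.
by move=> i _; exact: contentT.
Qed.

Let lU (A B : set (borel T)) : measurable A -> measurable B ->
  A `&` B = set0 -> l (A `|` B) = l A + l B.
Proof.
move=> mA mB AB; apply: cvg_lim => //.
under eq_fun do rewrite contentU//.
by apply: cvgD; exact: ultra_cvg (c01 _).
Qed.

Definition ultralimit_content : prob_content R T := ProbContent l_ge0 l_le1 lT lU.

Lemma ultralimit_content_cvg A : (fun i => c i A) @ U --> ultralimit_content A.
Proof. exact: ultra_cvg (c01 A). Qed.

End UltraLimit.

Lemma content_of_probability (R : realType) (T : ptopologicalType)
    (mu : probability (borel T) R) :
  exists c : prob_content R T, forall A : set (borel T), measurable A ->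
    (c A)%:E = mu A.
Proof.
(* The value of [mu] off the Borel sets is unspecified; 0 there keeps the bounds of [prob_content]
   valid on all sets. *)
pose c (A : set T) := if `[< measurable (A : set (borel T)) >] then fine (mu A) else 0.
have cE (A : set (borel T)) : measurable A -> (c A)%:E = mu A.
  by move=> mA; rewrite /c asboolT// fineK// fin_num_measure.
have c0 A : 0 <= c A.
  by rewrite /c; case: asboolP => // _; rewrite fine_ge0.
have c1 A : c A <= 1.
  rewrite /c; case: asboolP => // mA.
  by rewrite -lee_fin fineK ?fin_num_measure// probability_le1.
have cT : c setT = 1.
  by apply: EFin_inj; rewrite cE// probability_setT.
have cU (A B : set (borel T)) : measurable A -> measurable B ->
    A `&` B = set0 -> c (A `|` B) = c A + c B.
  move=> mA mB AB; apply: EFin_inj; rewrite EFinD !cE//; last exact: measurableU.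
  exact: measureU.
by exists (ProbContent c0 c1 cT cU).
Qed.

Lemma sum_cells (R : realType) d (S : measurableType d) (mu : probability S R)
    (n : nat) (phi : S -> nat) (D : set S) :
  (forall x, (phi x < n)%N) -> (forall a, measurable (phi @^-1` [set a])) ->
  measurable D ->
  \sum_(a < n) fine (mu (D `&` phi @^-1` [set (a : nat)])) = fine (mu D).
Proof.
move=> lt_n mphi mD.
have mF a : measurable (D `&` phi @^-1` [set a]) by exact: measurableI.
apply: EFin_inj; rewrite -sumEFin fineK ?fin_num_measure//.
under eq_bigr do rewrite fineK ?fin_num_measure//.
rewrite -(measure_bigsetU mu mF); last first.
  by move=> a b _ _ [x [[_ /= <-] [_ /= <-]]].
congr (mu _); rewrite -(bigcup_mkord n (fun a => D `&` phi @^-1` [set a])).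
apply/seteqP; split => [x [a _ []]//|x Dx].
by exists (phi x) => /=; [exact: lt_n|split].
Qed.

(** * Gluing of plans along a common factor *)

Section Gluing.
Context {R : realType} {J : finType} (j0 : J) (Z : ptopologicalType)
  (W : J -> ptopologicalType).
Hypotheses (pZ : @polish R Z) (pW : forall j, @polish R (W j)).
Variables (zeta : probability (borel Z) R)
  (tau : forall j, probability (borel (Z * W j)%type) R).
Hypothesis tau_fst : forall j,
  pushes_to (tau j) (fst : borel (Z * W j)%type -> borel Z) zeta.

(* The coordinate [None] carries the factor Z shared by all the tau_j. *)
Definition glue_space (o : option J) : ptopologicalType :=
  if o is Some j then W j else Z.
Local Notation T := glue_space.

(** A finite Borel partition of every factor, coded by labels of cells. One size bounds the labels
    of all factors, so that a choice of cells is a finite function into a single ordinal type;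
    labels with an empty cell are allowed. *)
Record discretization := Discretization {
  d_size : nat ;
  d_map : forall o, T o -> nat ;
  d_lt : forall o x, (@d_map o x < d_size)%N ;
  d_meas : forall o a, measurable (@d_map o @^-1` [set a] : set (borel (T o))) }.

Definition refines (b a : discretization) :=
  forall o x y, @d_map b o x = @d_map b o y -> @d_map a o x = @d_map a o y.

Lemma common_refinement (a b : discretization) :
  exists c, refines c a /\ refines c b.
Proof.
(* The two labels are the digits of [m o x] in base [d_size b], recovered by quotient and
   remainder. *)
pose m o x := (@d_map a o x * d_size b + @d_map b o x)%N.
have m_div o x : (m o x %/ d_size b)%N = @d_map a o x.
  have lt := d_lt b x; have b0 : (0 < d_size b)%N by exact: leq_ltn_trans lt.
  by rewrite /m divnMDl// divn_small// addn0.
have m_mod o x : (m o x %% d_size b)%N = @d_map b o x.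
  by rewrite /m modnMDl modn_small// d_lt.
have m_lt o x : (m o x < d_size a * d_size b)%N.
  apply: (@leq_trans (@d_map a o x * d_size b + d_size b)%N).
    by rewrite ltn_add2l d_lt.
  by rewrite addnC -mulSn leq_mul2r d_lt orbT.
have m_meas o i : measurable (m o @^-1` [set i] : set (borel (T o))).
  have -> : m o @^-1` [set i] = @d_map a o @^-1` [set (i %/ d_size b)%N]
      `&` @d_map b o @^-1` [set (i %% d_size b)%N].
    apply/seteqP; split => [x /= <-|x [/= ax bx]]; first by rewrite m_div m_mod.
    by rewrite /m ax bx -divn_eq.
  by apply: measurableI; exact: d_meas.
exists (Discretization m_lt m_meas); split => o x y /= mxy.
- by rewrite -!m_div mxy.
- by rewrite -!m_mod mxy.
Qed.

(** The two-cell partition into [A o] and its complement. Every refinement of it also has [A o] as a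
    union of cells. *)
Lemma saturating_discretization (A : forall o, set (borel (T o))) :
  (forall o, measurable (A o)) ->
  exists a, forall o x y, @d_map a o x = @d_map a o y -> A o x -> A o y.
Proof.
move=> mA; pose m o (x : T o) : nat := `[< A o x >].
have m_lt o x : (m o x < 2)%N by rewrite /m; case: asbool.
have m_meas o i : measurable (m o @^-1` [set i] : set (borel (T o))).
  have [->|->|->] : [\/ m o @^-1` [set i] = A o, m o @^-1` [set i] = ~` A o
      | m o @^-1` [set i] = set0].
  - case: i => [|[|i]]; [constructor 2|constructor 1|constructor 3];
      apply/seteqP; split => x //=; rewrite /m; by case: asboolP.
  - exact: mA.
  - exact: measurableC.
  - exact: measurable0.
exists (Discretization m_lt m_meas) => o x y /= mxy Ax; apply: contrapT => nAy.
by move: mxy; rewrite /m asboolT// asboolF.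
Qed.

(* The atomic law of a discretization draws the cell p of z, then independently
   for each j a cell of W_j according to tau_j conditioned on p, and represents
   every cell by one of its points.  The conditional weights of a null cell p are
   divisions by 0, but they are multiplied by [z p = 0]. *)
Section Atomic.
Variable a : discretization.
Let n := d_size a.
Let cell o (i : nat) : set (borel (T o)) := @d_map a o @^-1` [set i].
Arguments cell : clear implicits.
Let pt o i : T o := xget point (cell o i).
Let z (p : 'I_n) := fine (zeta (cell None p)).
Let t j (p i : 'I_n) := fine (tau j (cell None p `*` cell (Some j) i)).
Let w p (q : {ffun J -> 'I_n}) := z p * \prod_j (t j p (q j) / z p).
Let x (p : 'I_n) (q : {ffun J -> 'I_n}) : prod_topology T :=
  fun o => match o with None => pt None p | Some j => pt (Some j) (q j) end.
Let c (E : set (prod_topology T)) : R := \sum_p \sum_q w p q * \1_E (x p q).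

Let z_ge0 p : 0 <= z p. Proof. by rewrite fine_ge0. Qed.

Let w_ge0 p q : 0 <= w p q.
Proof.
by rewrite mulr_ge0// prodr_ge0// => j _; rewrite divr_ge0// fine_ge0.
Qed.

Let cell_meas o i : measurable (cell o i). Proof. exact: d_meas. Qed.
Arguments cell_meas : clear implicits.

Let tau_cell j (p : 'I_n) : fine (tau j (cell None p `*` setT)) = z p.
Proof.
rewrite /z -(tau_fst j (cell_meas None p)) /pushforward; congr (fine (tau j _)).
by apply/seteqP; split => [u []|u].
Qed.

Let sum_tau j (p : 'I_n) (B : set (borel (W j))) : measurable B ->
  \sum_(i < n) fine (tau j (cell None p `*` (B `&` cell (Some j) i))) =
  fine (tau j (cell None p `*` B)).
Proof.
move=> mB; rewrite -(@sum_cells R _ _ (tau j) n (fun u => @d_map a (Some j) u.2)).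
- apply: eq_bigr => i _; congr (fine (tau j _)).
  by apply/seteqP; split => [u [? [? ?]]|u [[? ?] ?]].
- by move=> u; exact: d_lt.
- move=> i; rewrite -[X in measurable X](_ : setT `*` cell (Some j) i = _).
    by apply: borel_setX => //; exact: (cell_meas (Some j) i).
  by apply/seteqP; split => [u []|u].
- by apply: borel_setX => //; exact: (cell_meas None p).
Qed.

Let sum_t j p : \sum_i t j p i = z p.
Proof.
rewrite -(tau_cell j p) -sum_tau//.
by apply: eq_bigr => i _; rewrite setTI.
Qed.

Let cylinder (A : forall o, set (T o)) j : set (prod_topology T) :=
  [set f : prod_topology T | A None (f None) /\ A (Some j) (f (Some j))].

(** A saturated set contains the representative of a nonempty cell exactly when it contains the
    cell, so moving mass to representatives does not change its weight. The coordinates other than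
    [j] are conditionally independent and sum to 1. *)
Lemma atomic_cylinder (A : forall o, set (borel (T o))) j :
  (forall o, measurable (A o)) ->
  (forall o x y, @d_map a o x = @d_map a o y -> A o x -> A o y) ->
  (c (cylinder A j))%:E = tau j (A None `*` A (Some j)).
Proof.
move=> mA satA.
have mN : measurable (A None : set (borel Z)) := mA None.
have mS i : measurable (A (Some i) : set (borel (W i))) := mA (Some i).
have mC i : measurable (cell None i : set (borel Z)) := cell_meas None i.
have in_cell o i y : cell o i y -> A o (pt o i) <-> A o y.
  move=> Cy; have Cp : cell o i (pt o i) by apply: xgetPex; exists y.
  by split; apply: (satA o); rewrite Cp Cy.
have cond j' p i : t j' p i * \1_(A (Some j')) (pt (Some j') i) =
    fine (tau j' (cell None p `*` (A (Some j') `&` cell (Some j') i))).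
  rewrite /t indicE.
  have [/set_mem Ai|/negP nA] := boolP (pt (Some j') i \in A (Some j')).
    rewrite mulr1; congr (fine (tau j' (_ `*` _))).
    apply/seteqP; split => [y Cy|y []//]; split => //.
    by apply/(in_cell _ _ _ Cy).
  rewrite mulr0 [X in tau j' X](_ : _ = set0) ?measure0//.
  rewrite -subset0 => -[u v] /= [_ [Av Cv]].
  by apply: nA; apply/mem_set/(in_cell _ _ _ Cv).
pose s (p : 'I_n) := fine (tau j (cell None p `*` A (Some j))).
have s_le (p : 'I_n) : s p <= z p.
  rewrite -(tau_cell j p) /s fine_le ?fin_num_measure//.
  - exact: borel_setX.
  - exact: borel_setX.
  apply: le_measure; rewrite ?inE.
  - exact: borel_setX.
  - exact: borel_setX.
  - by move=> u [].
have inner p : \sum_q w p q * \1_(A (Some j)) (pt (Some j) (q j)) = s p.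
  pose F (i : J) (b : 'I_n) : R :=
    t i p b / z p * (if i == j then \1_(A (Some i)) (pt (Some i) b) else 1).
  transitivity (z p * \sum_(q : {ffun J -> 'I_n}) \prod_i F i (q i)).
    rewrite mulr_sumr; apply: eq_bigr => q _; rewrite /w -mulrA; congr (_ * _).
    rewrite /F [RHS]big_split /=; congr (_ * _).
    by rewrite (bigD1 j)//= eqxx big1 ?mulr1// => i /negbTE ->.
  rewrite -(bigA_distr_bigA F) (bigD1 j)//=.
  (* On a null cell the conditional weights are meaningless, but both sides vanish since
     [0 <= s p <= z p]. *)
  have [z0|z0] := eqVneq (z p) 0.
    rewrite z0 mul0r; apply/eqP; rewrite eq_sym eq_le -{1}z0 s_le/=.
    by rewrite fine_ge0.
  rewrite [X in _ * (_ * X)]big1 => [|i /negbTE ij].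
    rewrite mulr1 /F eqxx mulr_sumr /s -sum_tau//; apply: eq_bigr => b _.
    by rewrite -cond; field.
  rewrite /F ij; under eq_bigr do rewrite mulr1.
  by rewrite -mulr_suml sum_t divff.
have -> : c (cylinder A j) = \sum_p s p * \1_(A None) (pt None p).
  apply: eq_bigr => p _; rewrite -inner mulr_suml; apply: eq_bigr => q _.
  rewrite -mulrA; congr (_ * _); rewrite !indicE -natrM mulnb; congr (_%:R).
  congr (nat_of_bool _); apply/idP/andP => [/set_mem[? ?]|[/set_mem ? /set_mem ?]].
    by split; exact/mem_set.
  exact/mem_set.
rewrite -[RHS]fineK ?fin_num_measure//; last exact: borel_setX.
rewrite -(@sum_cells R _ _ (tau j) n (fun u => @d_map a None u.1)).
- congr EFin; apply: eq_bigr => p _; rewrite /s indicE.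
  have [/set_mem Ap|/negP nA] := boolP (pt None p \in A None).
    rewrite mulr1; congr (fine (tau j _)).
    apply/seteqP; split => [u [Cu Au]|u [[Au Bu] Cu]]; split => //; split => //.
    by apply/(in_cell _ _ _ Cu).
  rewrite mulr0 [X in tau j X](_ : _ = set0) ?measure0//.
  rewrite -subset0 => -[u v] /= [[Au Bv] Cu].
  by apply: nA; apply/mem_set/(in_cell _ _ _ Cu).
- by move=> u; exact: d_lt.
- move=> i; rewrite -[X in measurable X](_ : cell None i `*` setT = _).
    exact: borel_setX.
  by apply/seteqP; split => [u []|u].
- exact: borel_setX.
Qed.

Let c_ge0 E : 0 <= c E.
Proof.
rewrite sumr_ge0// => p _; rewrite sumr_ge0// => q _.
by rewrite mulr_ge0// indicE.
Qed.

Let cT : c setT = 1.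
Proof.
apply: EFin_inj; have -> : setT = cylinder (fun=> setT) j0 by apply/seteqP; split.
rewrite atomic_cylinder// -[RHS](probability_setT (tau j0)); congr (tau j0 _).
by apply/seteqP; split.
Qed.

Let c_le1 E : c E <= 1.
Proof.
rewrite -cT; apply: ler_sum => p _; apply: ler_sum => q _.
by rewrite ler_wpM2l// !indicE in_setT lern1; case: (_ \in _).
Qed.

Let cU (A B : set (borel (prod_topology T))) : measurable A -> measurable B ->
  A `&` B = set0 -> c (A `|` B) = c A + c B.
Proof.
move=> _ _ AB; rewrite -big_split; apply: eq_bigr => p _ /=.
rewrite -big_split; apply: eq_bigr => q _ /=; rewrite -mulrDr; congr (_ * _).
rewrite !indicE in_setU -natrD; congr (_%:R).
have [/set_mem Ax|] := boolP (x p q \in A); last by rewrite add0n.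
have [/set_mem Bx|] := boolP (x p q \in B) => //.
by have : (A `&` B) (x p q) by []; rewrite AB.
Qed.

Lemma atomic_gluing : exists l : prob_content R (prod_topology T),
  forall (A : forall o, set (borel (T o))) j, (forall o, measurable (A o)) ->
  (forall o x y, @d_map a o x = @d_map a o y -> A o x -> A o y) ->
  (l [set f : prod_topology T | A None (f None) /\ A (Some j) (f (Some j))])%:E =
  tau j (A None `*` A (Some j)).
Proof. by exists (ProbContent c_ge0 c_le1 cT cU) => A j; exact: atomic_cylinder. Qed.

End Atomic.

(** The ultrafilter is finer than the filter of refinements. Hence each fixed rectangle is
    eventually saturated, and from then on its atomic weight equals its [tau j] mass exactly. *)
Lemma gluing_exists : exists gamma : probability (borel (prod_topology T)) R,
  forall j (C : set (borel Z)) (B : set (borel (W j))),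
    measurable C -> measurable B ->
    gamma [set f : prod_topology T | C (f None) /\ B (f (Some j))] = tau j (C `*` B).
Proof.
have /choice[l hl] := atomic_gluing.
pose F : set_system discretization := filter_from setT (fun a => [set b | refines b a]).
have [a0 _] := @saturating_discretization (fun=> setT) (fun=> measurableT).
have FF : ProperFilter F.
  apply: filter_from_proper; last by move=> a _; exists a.
  apply: filter_from_filter; first by exists a0.
  move=> a b _ _; have [c [ca cb]] := common_refinement a b.
  by exists c => // e ec; split => o x y /ec; [exact: ca|exact: cb].
have [U [UU FU]] := ultraFilterLemma FF.
pose L := ultralimit_content l (UU := UU).
have LE (A : forall o, set (borel (T o))) j : (forall o, measurable (A o)) ->
    (L [set f : prod_topology T | A None (f None) /\ A (Some j) (f (Some j))])%:E =
    tau j (A None `*` A (Some j)).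
  move=> mA; have [a ha] := saturating_discretization mA.
  have mP : measurable (A None `*` A (Some j) : set (borel (Z * W j)%type)).
    by apply: borel_setX; [exact: (mA None)|exact: (mA (Some j))].
  rewrite -[RHS]fineK ?fin_num_measure//.
  congr EFin; apply: ultra_lim_eq; apply: FU; exists a => // b ba /=.
  apply: EFin_inj; rewrite hl//; last by move=> o x y /ba; exact: ha.
  by rewrite fineK// fin_num_measure.
have ms j : measurable_fun setT (snd : borel (Z * W j)%type -> borel (W j)).
  by apply: continuous_borel => u; exact: cvg_snd.
pose xi (o : option J) : probability (borel (T o)) R :=
  match o with None => zeta | Some j => push_prob (tau j) (ms j) end.
have pT o : @polish R (T o) by case: o.
have Lxi (o : option J) (A : set (borel (T o))) : measurable A ->
    (L ((fun f : prod_topology T => f o) @^-1` A))%:E = xi o A.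
  move=> mA.
  (* [LE] speaks of rectangles in two coordinates; a set in the single coordinate [o] is completed
     by full sides. *)
  pose B : forall o, set (borel (T o)) :=
    @dfwith _ (fun o => set (borel (T o))) (fun=> setT) o A.
  have mB o' : measurable (B o') by rewrite /B; case: dfwithP.
  have Bo : B o = A by rewrite /B dfwithin.
  have BN o' : o != o' -> B o' = setT by move=> oo'; rewrite /B dfwithout.
  move: A mA @B mB Bo BN; case: o => [j|] A mA B mB Bo BN.
    have BN' : B None = setT by exact: BN.
    have := LE B j mB; rewrite Bo BN' => LB.
    transitivity (tau j ([set: Z] `*` A)).
      rewrite -LB; congr (L _)%:E; apply/seteqP; split => [f|f []//].
      by split.
    rewrite /= /push_prob /distribution /= /pushforward; congr (tau j _).
    by apply/seteqP; split => [u []|u].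
  have BS : B (Some j0) = setT by exact: BN.
  have := LE B j0 mB; rewrite Bo BS => LB.
  transitivity (tau j0 (A `*` [set: W j0])).
    rewrite -LB; congr (L _)%:E; apply/seteqP; split => [f|f []//].
    by split.
  rewrite /= -(tau_fst j0 mA) /pushforward; congr (tau j0 _).
  by apply/seteqP; split => [u []|u].
have [gamma hgamma] := box_content_extension pT Lxi.
exists gamma => j C B mC mB.
pose D0 : forall o, set (borel (T o)) :=
  @dfwith _ (fun o => set (borel (T o))) (fun=> setT) None C.
pose D : forall o, set (borel (T o)) :=
  @dfwith _ (fun o => set (borel (T o))) D0 (Some j) B.
have mD o : measurable (D o).
  rewrite /D; case: dfwithP => [|o' _]; first exact: mB.
  by rewrite /D0; case: dfwithP => //; exact: mC.
have DN : D None = C by rewrite /D dfwithout// /D0 dfwithin.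
have DS : D (Some j) = B by rewrite /D dfwithin.
have CBD (f : prod_topology T) : C (f None) -> B (f (Some j)) -> box D f.
  move=> Cf Bf o; rewrite /D; case: dfwithP => // o' _.
  by rewrite /D0; case: dfwithP.
have -> : [set f : prod_topology T | C (f None) /\ B (f (Some j))] = box D.
  apply/seteqP; split => [f [Cf Bf]|f Df]; first exact: CBD.
  by split; [rewrite -DN|rewrite -DS]; exact: Df.
rewrite hgamma//; have := LE D j mD; rewrite DN DS => <-.
congr (L _)%:E; apply/seteqP; split => [f Df|f [Cf Bf]]; last exact: CBD.
by split; [rewrite -DN|rewrite -DS]; exact: Df.
Qed.

End Gluing.

(** * Density of rectangle-simple functions in L2 *)

Section L2Norm.
Context {R : realType} d (S : measurableType d) (mu : probability S R).
Implicit Types f g h : S -> R.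

Local Notation N f := ('N[mu]_2%:E[EFin \o (f : S -> R)%R])%E.

Lemma L2normD f g : measurable_fun setT f -> measurable_fun setT g ->
  (N (fun x => f x + g x)%R <= N f + N g)%E.
Proof. by move=> mf mg; apply: minkowski_EFin => //; rewrite ler1n. Qed.

Lemma L2normN f : N (fun x => - f x) = N f.
Proof. by rewrite -(oppe_Lnorm mu (EFin \o f)); apply: eq_Lnorm. Qed.

Lemma L2normC f g : N (fun x => f x - g x) = N (fun x => g x - f x).
Proof. by rewrite -L2normN; apply: eq_Lnorm => x /=; rewrite opprB. Qed.

Lemma L2norm_triangle g f h : measurable_fun setT f -> measurable_fun setT g ->
  measurable_fun setT h ->
  (N (fun x => f x - h x)%R <= N (fun x => f x - g x)%R + N (fun x => g x - h x)%R)%E.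
Proof.
move=> mf mg mh; have := @L2normD (f \- g)%R (g \- h)%R
  (measurable_funB mf mg) (measurable_funB mg mh).
rewrite (eq_Lnorm _ _ (g := EFin \o (fun x => f x - h x)%R))// => x /=.
by rewrite addrA subrK.
Qed.

Lemma L2norm_sqr f : measurable_fun setT f -> (N f ^+ 2 = \int[mu]_x (f x ^+ 2)%:E)%E.
Proof.
move=> mf; rewrite unlock poweR12_sqrt; last first.
  by apply: integral_ge0 => x _; exact: poweR_ge0.
rewrite sqr_sqrte; last by apply: integral_ge0 => x _; exact: poweR_ge0.
by apply: eq_integral => x _ /=; rewrite powR_mulrn// real_normK// num_real.
Qed.

Lemma L2norm_le f (e : R) : measurable_fun setT f -> 0 <= e ->
  (\int[mu]_x (f x ^+ 2)%:E <= (e ^+ 2)%:E)%E -> (N f <= e%:E)%E.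
Proof.
move=> mf e0; rewrite -L2norm_sqr// => h; apply: lee_sqrE; first by rewrite lee_fin.
by rewrite -EFin_expe.
Qed.

Lemma measurable_sqr f : measurable_fun setT f -> measurable_fun setT (fun x => f x ^+ 2).
Proof. exact: measurable_funX. Qed.

Lemma L2normZ (a : R) f : measurable_fun setT f ->
  N (fun x => a * f x) = (`|a|%:E * N f)%E.
Proof.
move=> mf; rewrite unlock.
have -> : (\int[mu]_x (`|(EFin \o (fun x => a * f x)%R) x| `^ 2) =
    \int[mu]_x ((`|a|%:E `^ 2) * (`|(EFin \o f) x| `^ 2)))%E.
  by apply: eq_integral => x _; rewrite -poweRM//= normrM.
rewrite ge0_integralZl//.
- rewrite poweRM ?poweR_ge0 ?integral_ge0// => [|x _]; last exact: poweR_ge0.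
  by rewrite -poweRrM mulfV ?pnatr_eq0// poweRe1.
- apply: (@measurableT_comp _ _ _ _ _ _ (fun x : \bar R => x `^ 2)%E).
    exact: measurable_poweR.
  by apply/measurable_EFinP; apply: measurableT_comp.
- by move=> x _; exact: poweR_ge0.
- exact: poweR_ge0.
Qed.

(** Dominated convergence for the squares, with the square of [w] as dominating function. *)
Lemma L2norm_vanish (u : nat -> S -> R) (w : S -> R) (e : R) : 0 < e ->
  (forall n, measurable_fun setT (u n)) -> measurable_fun setT w ->
  (N w < +oo)%E -> (forall n x, `|u n x| <= w x) ->
  (forall x, u n x @[n --> \oo] --> 0) -> exists n, (N (u n) <= e%:E)%E.
Proof.
move=> e0 mu_ mw Nw uw u0.
have mw2 : measurable_fun setT (fun x => (w x ^+ 2)%:E).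
  by apply/measurable_EFinP; exact: measurable_sqr.
have iw : mu.-integrable setT (fun x => (w x ^+ 2)%:E).
  apply/integrableP; split => //.
  under eq_integral => x _ do rewrite gee0_abs ?lee_fin ?sqr_ge0//.
  have /fineK Nw' : N w \is a fin_num by rewrite ge0_fin_numE// Lnorm_ge0.
  by rewrite -L2norm_sqr// -Nw' -EFin_expe ltry.
have hu0 : {ae mu, forall x, setT x -> (u n x ^+ 2)%:E @[n --> \oo] --> 0%E}.
  apply: aeW => x _; apply: cvg_EFin; first by apply: nearW.
  have h := cvgM (u0 x) (u0 x); rewrite mul0r in h.
  rewrite (_ : _ \o _ = (u^~ x \* u^~ x)); first exact: h.
  by apply/funext => n /=; rewrite expr2.
have huw : {ae mu, forall x n, setT x -> (`|(u n x ^+ 2)%:E| <= (w x ^+ 2)%:E)%E}.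
  apply: aeW => x n _; rewrite gee0_abs ?lee_fin ?sqr_ge0//.
  by rewrite -[leLHS]real_normK ?num_real// lerXn2r ?nnegrE// (le_trans _ (uw n x)).
have [_ _] := dominated_convergence measurableT
  (fun n => (measurable_EFinP _ _).2 (measurable_sqr (mu_ n)))
  (measurable_cst 0%E) hu0 iw huw.
rewrite integral0 => h.
have [n _ /(_ n (leqnn n)) /= hn] :
    \forall n \near \oo, (\int[mu]_x (u n x ^+ 2)%:E < (e ^+ 2)%:E)%E.
  apply: (h [set x | (x < (e ^+ 2)%:E)%E]).
  apply: open_nbhs_nbhs; split; first exact: open_ereal_lt_ereal.
  by rewrite /= lte_fin exprn_gt0.
by exists n; apply: L2norm_le => //; exact: ltW.
Qed.

Lemma L2norm_bounded f (M : R) : measurable_fun setT f -> (forall x, `|f x| <= M) ->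
  (N f < +oo)%E.
Proof.
move=> mf fM; have M0 : 0 <= M by apply: le_trans (fM point); exact: normr_ge0.
apply: (@le_lt_trans _ _ M%:E); last exact: ltry.
apply: L2norm_le => //.
have -> : ((M ^+ 2)%:E = \int[mu]_x (M ^+ 2)%:E)%E.
  by rewrite integral_cst//= probability_setT mule1.
apply: ge0_le_integral => //.
- by move=> x _; rewrite lee_fin sqr_ge0.
- by apply/measurable_EFinP; exact: measurable_sqr.
- by move=> x _; rewrite lee_fin -[leLHS]real_normK ?num_real// lerXn2r.
Qed.

End L2Norm.

(** The linear span of the indicators of rectangles with sides in [G]. The sides are arbitrary
    measurable sets when density is proved, and boxes when convergence is proved, since a limit law
    is known only on boxes. *)
Inductive rect_simple (R : realType) (S : Type) (G : set (set S)) :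
    (S * S -> R) -> Prop :=
| rect_simple_indic A B : G A -> G B ->
    rect_simple G (fun z => \1_A z.1 * \1_B z.2)
| rect_simple_lin a f g : rect_simple G f -> rect_simple G g ->
    rect_simple G (fun z => a * f z + g z).

Lemma rect_simple0 (R : realType) (S : Type) (G : set (set S)) (A : set S) :
  G A -> rect_simple G (fun=> 0 : R).
Proof.
move=> GA; have ss := @rect_simple_indic R S G A A GA GA.
have := rect_simple_lin (-1) ss ss.
by congr rect_simple; apply/funext => z; rewrite mulN1r addNr.
Qed.

Section RectSimple.
Context {R : realType} d (S : measurableType d).
Variable mu : probability (S * S)%type R.
Implicit Types f g u : S * S -> R.

Local Notation N f := ('N[mu]_2%:E[EFin \o (f : S * S -> R)%R])%E.
Local Notation simple := (@rect_simple R S measurable).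

Lemma rect_simple_bounded (G : set (set S)) f : G `<=` measurable ->
  rect_simple G f -> measurable_fun setT f /\ exists M : R, forall z, `|f z| <= M.
Proof.
move=> Gm; elim=> [A B /Gm mA /Gm mB|a {}f g _ [mf [M fM]] _ [mg [M' gM']]].
  split.
    apply: measurable_funM.
      exact: (measurableT_comp (measurable_indic mA) measurable_fst).
    exact: (measurableT_comp (measurable_indic mB) measurable_snd).
  exists 1 => z; rewrite normrM !indicE !normr_nat -natrM.
  by case: (_ \in _); case: (_ \in _) => /=; rewrite ?mul0n ?muln0 ?muln1 ?ler01.
split; first by apply: measurable_funD => //; apply: measurable_funM.
exists (`|a| * M + M') => z; apply: le_trans (ler_normD _ _) _.
by rewrite lerD// normrM ler_wpM2l.
Qed.

Definition L2_approx u := measurable_fun setT u /\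
  forall e : R, 0 < e -> exists2 s, simple s & (N (fun z => u z - s z)%R <= e%:E)%E.

Lemma simple_measurable s : simple s -> measurable_fun setT s.
Proof. by move=> ss; have [] := rect_simple_bounded (@subset_refl _ _) ss. Qed.

Lemma simple_L2_approx s : simple s -> L2_approx s.
Proof.
move=> ss; split; first exact: simple_measurable.
move=> e e0; exists s => //.
rewrite (eq_Lnorm _ _ (g := cst 0%E)) ?Lnorm0 ?lee_fin ?ltW// => z /=.
by rewrite subrr.
Qed.

Lemma L2_approx_lin a u v : L2_approx u -> L2_approx v ->
  L2_approx (fun z => a * u z + v z).
Proof.
move=> [mu_ hu] [mv hv].
split; first by apply: measurable_funD => //; apply: measurable_funM.
(* Adding 1 keeps the divisor positive when [a] is 0. *)
move=> e e0; have d0 : 0 < e / 2 / (`|a| + 1) by rewrite !divr_gt0// ltr_wpDl.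
have [s ss hs] := hu _ d0; have [t st ht] := hv (e / 2) (ltac:(by rewrite divr_gt0)).
exists (fun z => a * s z + t z); first exact: rect_simple_lin.
have ms := simple_measurable ss; have mt := simple_measurable st.
rewrite (eq_Lnorm _ _
  (g := EFin \o (fun z => (a * (u z - s z) + (v z - t z))%R))); last first.
  by move=> z /=; congr EFin; ring.
apply: le_trans (L2normD _ _ _) _.
- by apply: measurable_funM => //; exact: measurable_funB.
- exact: measurable_funB.
rewrite (splitr e) [leRHS]EFinD leeD// L2normZ; last exact: measurable_funB.
apply: (@le_trans _ _ (`|a|%:E * (e / 2 / (`|a| + 1))%:E)%E).
  by rewrite lee_wpmul2l// lee_fin.
rewrite -EFinM lee_fin mulrCA ger_pMr ?divr_gt0//.
by rewrite ler_pdivrMr ?ltr_wpDl// mul1r lerDl.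
Qed.

Lemma L2_approx_closed u : measurable_fun setT u ->
  (forall e : R, 0 < e ->
    exists2 v, L2_approx v & (N (fun z => u z - v z)%R <= e%:E)%E) ->
  L2_approx u.
Proof.
move=> mu_ h; split => // e e0; have e2 : 0 < e / 2 by rewrite divr_gt0.
have [v [mv hv] uv] := h _ e2; have [s ss vs] := hv _ e2.
exists s => //; rewrite (splitr e) [leRHS]EFinD.
apply: le_trans (L2norm_triangle _ mu_ mv _) (leeD uv vs).
exact: simple_measurable.
Qed.

Lemma L2_approx_sum (I : Type) (r : seq I) (F : I -> S * S -> R) :
  (forall i, L2_approx (F i)) -> L2_approx (fun z => \sum_(i <- r) F i z).
Proof.
move=> hF; elim: r => [|i r IH].
  by under eq_fun do rewrite big_nil; apply: simple_L2_approx; exact: rect_simple0 measurableT.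
under eq_fun do rewrite big_cons.
have := L2_approx_lin 1 (hF i) IH.
by congr L2_approx; apply/funext => z; rewrite mul1r.
Qed.

(** Dynkin's theorem from the rectangles: complements are differences with the constant 1, and for a
    disjoint union the tails vanish in L2 by dominated convergence. *)
Lemma L2_approx_indic (C : set (S * S)) : measurable C -> L2_approx \1_C.
Proof.
pose G : set (set (S * S)) :=
  [set C | exists A B, [/\ measurable A, measurable B & C = A `*` B]].
have GE : @measurable _ (S * S)%type = <<s G >>.
  rewrite measurable_prod_measurableType; congr (<<s _ >>).
  apply/seteqP; split => [_ [A mA [B mB <-]]|_ [A [B [mA mB ->]]]]; first by exists A, B.
  by exists A => //; exists B.
have G1 C' : G C' -> L2_approx \1_C'.
  move=> [A [B [mA mB ->]]]; apply: simple_L2_approx.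
  rewrite [X in simple X](_ : _ = (fun z => \1_A z.1 * \1_B z.2)).
    exact: rect_simple_indic.
  apply/funext => z; rewrite !indicE -natrM mulnb; congr (nat_of_bool _)%:R.
  by rewrite in_setX.
move=> mC; have := mC; rewrite GE.
apply: (@dynkin_induction _ _ G (fun C => L2_approx \1_C)) => //.
- move=> _ _ [A [B [mA mB ->]]] [A' [B' [mA' mB' ->]]].
  exists (A `&` A'), (B `&` B'); split; [exact: measurableI..|].
  by apply/seteqP; split => -[x y] /= [[? ?] [? ?]].
- by apply: G1; exists setT, setT; split => //; apply/seteqP; split.
- move=> D mD hD; have hT : L2_approx \1_(setT : set (S * S)).
    by apply: G1; exists setT, setT; split => //; apply/seteqP; split.
  have := L2_approx_lin (-1) hD hT; congr L2_approx; apply/funext => z.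
  rewrite !indicE in_setT in_setC mulN1r addrC.
  by case: (_ \in _); rewrite ?subrr ?subr0.
- move=> F mF tF hF.
  apply: L2_approx_closed; first by apply: measurable_indic; exact: bigcupT_measurable.
  move=> e e0.
  pose U n := \big[setU/set0]_(i < n) F i.
  have UE n z : (\sum_(i <- iota 0 n) \1_(F i) z : R) = \1_(U n) z.
    elim: n => [|n IH]; first by rewrite big_nil /U big_ord0 indicE in_set0.
    rewrite -addn1 iotaD big_cat big_seq1 /= IH addn1 /U big_ord_recr /= -/(U n).
    rewrite !indicE in_setU -natrD; congr (_%:R).
    have [/set_mem Fz|] := boolP (z \in F n); last by rewrite orbF addn0.
    have [/set_mem|//] := boolP (z \in U n).
    rewrite /U -bigcup_mkord => -[i /= lin Fi].
    have := tF i n Logic.I Logic.I (ltac:(by exists z)).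
    by move=> in_; rewrite in_ ltnn in lin.
  have mU n : measurable ((\bigcup_k F k) `\` U n).
    by apply: measurableD; [exact: bigcupT_measurable|exact: bigsetU_measurable].
  have N1 : (N (cst 1) < +oo)%E.
    by apply: (@L2norm_bounded _ _ _ mu _ 1) => [|z]; rewrite ?normr1.
  have le1 n z : `|\1_((\bigcup_k F k) `\` U n) z : R| <= cst 1 z.
    by rewrite indicE normr_nat lern1; case: (_ \in _).
  have to0 z : (\1_((\bigcup_k F k) `\` U n) z : R) @[n --> \oo] --> 0.
    apply: cvg_near_cst.
    have [[i _ Fi]|nF] := pselect ((\bigcup_k F k) z); last first.
      by apply: nearW => n; rewrite indicE memNset// => -[].
    exists i.+1 => // n /= lin; rewrite indicE memNset// => -[_]; apply.
    by rewrite /U -bigcup_mkord; exists i.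
  have [n hn] := L2norm_vanish e0 (fun n => measurable_indic (mU n))
    (measurable_cst _) N1 le1 to0.
  exists (fun z => \sum_(i <- iota 0 n) \1_(F i) z); first exact: L2_approx_sum.
  rewrite (eq_Lnorm _ _ (g := EFin \o \1_((\bigcup_k F k) `\` U n)))// => z /=.
  congr EFin; rewrite UE !indicE in_setD.
  have [/set_mem|_] := boolP (z \in U n); last by rewrite andbT subr0.
  rewrite /U -bigcup_mkord => -[i _ Fi]; rewrite andbF mem_set ?subrr//.
  by exists i.
Qed.

Import HBSimple HBNNSimple.

Lemma L2_approx_nnsfun (f : {nnsfun (S * S)%type >-> R}) : L2_approx f.
Proof.
(* The summand [+ 0] gives each term the shape expected by [L2_approx_lin]. *)
rewrite (_ : (f : _ -> _) = (fun z =>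
    \sum_(y <- finmap.enum_fset (fset_set (range f)))
      (y * \1_(f @^-1` [set y]) z + 0))).
  apply: L2_approx_sum => y; apply: L2_approx_lin.
    by apply: L2_approx_indic; exact: measurable_sfunP.
  by apply: simple_L2_approx; exact: rect_simple0 measurableT.
apply/funext => z; rewrite fimfunE fsbig_finite//=.
by apply: eq_bigr => y _; rewrite addr0.
Qed.

(** The increasing simple approximations of [u] differ from it by at most [u], which dominates the
    error in L2. *)
Lemma L2_approx_ge0 u : measurable_fun setT u -> (forall z, 0 <= u z) ->
  (N u < +oo)%E -> L2_approx u.
Proof.
move=> mu_ u0 Nu; apply: L2_approx_closed => // e e0.
have mEu : measurable_fun setT (EFin \o u) by apply/measurable_EFinP.
pose f n : S * S -> R := nnsfun_approx measurableT mEu n.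
have cf z : f n z @[n --> \oo] --> u z.
  have := @cvg_nnsfun_approx _ _ _ _ measurableT _ mEu (fun z _ => u0 z) z Logic.I.
  by move/fine_cvg.
have fle n z : 0 <= u z - f n z <= u z.
  rewrite subr_ge0 lerBlDr lerDl fun_ge0 andbT.
  rewrite -(cvg_lim _ (cf z))//; apply: (@nondecreasing_cvgn_le _ (f ^~ z)).
    by move=> m k /(nd_nnsfun_approx measurableT mEu)/lefP; exact.
  by apply: cvgP; exact: cf.
have mf n : measurable_fun setT (f n) by exact: measurable_funPT.
have le_u n z : `|u z - f n z| <= u z.
  by have /andP[h0 h1] := fle n z; rewrite ger0_norm.
have to0 z : u z - f n z @[n --> \oo] --> 0.
  by rewrite -[X in _ --> X](subrr (u z)); apply: cvgB => //; exact: cvg_cst.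
have [n hn] := L2norm_vanish e0 (fun n => measurable_funB mu_ (mf n)) mu_ Nu le_u to0.
exists (f n) => //; exact: L2_approx_nnsfun.
Qed.

Lemma L2_dense u : measurable_fun setT u -> (N u < +oo)%E -> L2_approx u.
Proof.
move=> mu_ Nu.
have key (v : S * S -> R) : measurable_fun setT v -> (forall z, 0 <= v z) ->
    (forall z, v z <= `|u z|) -> L2_approx v.
  move=> mv v0 vu; apply: L2_approx_ge0 => //; apply: le_lt_trans Nu.
  apply: lee_sqrE; first exact: Lnorm_ge0.
  rewrite !L2norm_sqr//; apply: ge0_le_integral => //.
  - by move=> z _; rewrite lee_fin sqr_ge0.
  - by apply/measurable_EFinP; exact: measurable_sqr.
  - by apply/measurable_EFinP; exact: measurable_sqr.
  - by move=> z _; rewrite lee_fin -[leRHS]real_normK ?num_real// lerXn2r ?nnegrE.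
have neg : L2_approx (fun z => Num.max (- u z) 0).
  apply: key => [|z|z]; last by rewrite ge_max normr_ge0 -normrN ler_norm.
    by apply: measurable_maxr => //; exact: measurableT_comp.
  by rewrite le_max lexx orbT.
have pos : L2_approx (fun z => Num.max (u z) 0).
  apply: key => [|z|z]; last by rewrite ge_max normr_ge0 ler_norm.
    exact: measurable_maxr.
  by rewrite le_max lexx orbT.
have := L2_approx_lin (-1) neg pos; congr L2_approx; apply/funext => z.
rewrite mulN1r addrC; case: (leP 0 (u z)) => uz.
  by rewrite max_r ?subr0 ?oppr_le0.
by rewrite max_l ?oppr_ge0 ?ltW// sub0r opprK.
Qed.

End RectSimple.

(** * Compactness of couplings with given marginals *)

Lemma dist_le_thirds (R : realFieldType) (a b c d e : R) :
  `|a - b| <= e / 3%:R -> `|c - d| <= e / 3%:R -> `|b - d| <= e / 3%:R ->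
  `|a - c| <= e.
Proof.
rewrite !ler_norml => /andP[? ?] /andP[? ?] /andP[? ?].
by apply/andP; split; lra.
Qed.

Section NormSum.
Context {R : realType} d (S : measurableType d) (mu : probability S R).
Implicit Types f g : S -> R.

Local Notation N f := ('N[mu]_2%:E[EFin \o (f : S -> R)%R])%E.

Lemma L2norm_sum (I : Type) (r : seq I) (f : I -> S -> R) :
  (forall i, measurable_fun setT (f i)) ->
  (N (fun z => \sum_(i <- r) f i z)%R <= \sum_(i <- r) N (f i))%E.
Proof.
move=> mf; elim: r => [|i r IH].
  rewrite big_nil (eq_Lnorm _ _ (g := cst 0%E)) ?Lnorm0// => z /=.
  by rewrite big_nil.
rewrite big_cons (eq_Lnorm _ _ (g := EFin \o (fun z => (f i z + \sum_(i <- r) f i z)%R))).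
  by apply: le_trans (L2normD _ _ _) _ => //; [exact: measurable_sum|exact: leeD].
by move=> z /=; rewrite big_cons.
Qed.

Lemma L2norm_dist f g (e : R) : measurable_fun setT f -> measurable_fun setT g ->
  (N f < +oo)%E -> (N g < +oo)%E -> (N (fun z => f z - g z)%R <= e%:E)%E ->
  `|fine (N f) - fine (N g)| <= e.
Proof.
move=> mf mg Nf Ng fg.
have tri h k : measurable_fun setT h -> measurable_fun setT k ->
    (N h < +oo)%E -> (N k < +oo)%E -> (N (fun z => h z - k z)%R <= e%:E)%E ->
    fine (N h) - fine (N k) <= e.
  move=> mh mk Nh Nk hk; rewrite lerBlDr -lee_fin [leRHS]EFinD.
  rewrite !fineK ?ge0_fin_numE ?Lnorm_ge0//.
  have := L2normD mu (measurable_funB mh mk) mk.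
  rewrite (eq_Lnorm _ _ (g := EFin \o h)); last by move=> z /=; rewrite subrK.
  by move=> /le_trans; apply; rewrite leeD.
rewrite ler_norml lerNl opprB; apply/andP; split; last exact: tri.
by apply: tri => //; rewrite L2normC.
Qed.

(** The square is written as a product of two functions so that [bilinear_cvg] applies. *)
Lemma L2norm_simple f (M : R) : measurable_fun setT f -> (forall z, `|f z| <= M) ->
  fine (N f) = Num.sqrt (\int[mu]_z (f z * f z)).
Proof.
move=> mf fM; rewrite /Rintegral.
have -> : (\int[mu]_z (f z * f z)%:E = N f ^+ 2)%E.
  by rewrite L2norm_sqr//; apply: eq_integral => z _; rewrite expr2.
have /fineK <- : N f \is a fin_num.
  by rewrite ge0_fin_numE ?Lnorm_ge0// (L2norm_bounded mu mf fM).
by rewrite -EFin_expe /= sqrtr_sqr ger0_norm// fine_ge0// Lnorm_ge0.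
Qed.

End NormSum.

Section BilinearConvergence.
Context {R : realType} d (S : measurableType d) (G : set (set S)).
Hypotheses (Gm : G `<=` measurable) (GI : setI_closed G).
Context {I : Type} (U : set_system I) {UU : ProperFilter U}.
Variables (mu : I -> probability S R) (nu : probability S R).
Hypothesis munu : forall A, G A -> fine (mu i A) @[i --> U] --> fine (nu A).

Local Notation simple := (@rect_simple R S G).

Let bounded_integrable (m : probability (S * S)%type R) (f : S * S -> R) :
  measurable_fun setT f -> (exists M, forall z, `|f z| <= M) ->
  m.-integrable setT (EFin \o f).
Proof.
move=> mf [M fM]; apply: measurable_bounded_integrable => //.
  by rewrite -ge0_fin_numE// fin_num_measure.
by exists M; split; [rewrite num_real|move=> x Mx z _; exact: le_trans (ltW Mx)].
Qed.

Let simpleM_bounded (f g : S * S -> R) : simple f -> simple g ->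
  measurable_fun setT (fun z => f z * g z) /\ exists M, forall z, `|f z * g z| <= M.
Proof.
move=> /(rect_simple_bounded Gm)[mf [M fM]] /(rect_simple_bounded Gm)[mg [M' gM]].
split; first exact: measurable_funM.
by exists (M * M') => z; rewrite normrM ler_pM.
Qed.

Let rectE (m : probability S R) A B C D : G A -> G B -> G C -> G D ->
  \int[(m \x m)%E]_z (\1_A z.1 * \1_B z.2 * (\1_C z.1 * \1_D z.2)) =
  fine (m (A `&` C)) * fine (m (B `&` D)).
Proof.
move=> /Gm mA /Gm mB /Gm mC /Gm mD.
have mAC : measurable (A `&` C) by exact: measurableI.
have mBD : measurable (B `&` D) by exact: measurableI.
rewrite -fineM ?fin_num_measure// -product_measure1E//.
rewrite -[in RHS](setIT (_ `*` _)) -integral_indic//; last exact: measurableX.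
congr fine; apply: eq_integral => z _; congr EFin; rewrite !indicE -!natrM !mulnb.
congr (nat_of_bool _)%:R; rewrite in_setX !in_setI.
by case: (_ \in A); case: (_ \in B); case: (_ \in C); case: (_ \in D).
Qed.

(** For two rectangle indicators the integral is a product of two masses of sets in [G], each of
    which converges. The bilinear form, unlike the square of one function, is accessible to
    induction on each argument. *)
Lemma bilinear_cvg (f g : S * S -> R) : simple f -> simple g ->
  \int[(mu i \x mu i)%E]_z (f z * g z) @[i --> U] --> \int[(nu \x nu)%E]_z (f z * g z).
Proof.
move=> sf; elim: sf g => [A B GA GB g|a {}f f' sf IHf sf' IHf' g sg].
  elim=> [C D GC GD|a {}g g' sg IHg sg' IHg'].
    under eq_fun do rewrite rectE//.
    by rewrite rectE//; apply: cvgM; apply: munu; exact: GI.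
  have lin (m : probability (S * S)%type R) :
      \int[m]_z (\1_A z.1 * \1_B z.2 * (a * g z + g' z)) =
      a * \int[m]_z (\1_A z.1 * \1_B z.2 * g z) +
      \int[m]_z (\1_A z.1 * \1_B z.2 * g' z).
    have sAB : simple (fun z => \1_A z.1 * \1_B z.2) by exact: rect_simple_indic.
    have [m1 b1] := simpleM_bounded sAB sg; have [m2 b2] := simpleM_bounded sAB sg'.
    rewrite -RintegralZl//; last exact: bounded_integrable.
    rewrite -RintegralD//; last 2 first.
    - apply: bounded_integrable; first exact: measurable_funM.
      by have [M hM] := b1; exists (`|a| * M) => z; rewrite normrM ler_wpM2l.
    - exact: bounded_integrable.
    by apply: eq_Rintegral => z _; ring.
  under eq_fun do rewrite lin.
  by rewrite lin; apply: cvgD => //; apply: cvgM => //; exact: cvg_cst.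
have lin (m : probability (S * S)%type R) : \int[m]_z ((a * f z + f' z) * g z) =
    a * \int[m]_z (f z * g z) + \int[m]_z (f' z * g z).
  have [m1 b1] := simpleM_bounded sf sg; have [m2 b2] := simpleM_bounded sf' sg.
  rewrite -RintegralZl//; last exact: bounded_integrable.
  rewrite -RintegralD//; last 2 first.
  - apply: bounded_integrable; first exact: measurable_funM.
    by have [M hM] := b1; exists (`|a| * M) => z; rewrite normrM ler_wpM2l.
  - exact: bounded_integrable.
  by apply: eq_Rintegral => z _; ring.
under eq_fun do rewrite lin.
by rewrite lin; apply: cvgD => //; [apply: cvgM; [exact: cvg_cst|exact: IHf]|exact: IHf'].
Qed.

Lemma simple_L2norm_cvg (f : S * S -> R) : simple f ->
  fine ('N[(mu i \x mu i)%E]_2%:E[EFin \o f])%E @[i --> U] -->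
  fine ('N[(nu \x nu)%E]_2%:E[EFin \o f])%E.
Proof.
move=> sf; have [mf [M fM]] := rect_simple_bounded Gm sf.
under eq_fun do rewrite (L2norm_simple _ mf fM).
rewrite (L2norm_simple _ mf fM).
apply: continuous_cvg; first exact: sqrt_continuous.
exact: bilinear_cvg.
Qed.

End BilinearConvergence.

Notation borel2 T := (borel T * borel T)%type.

Lemma measurable_pullback (R : realType) (S T : ptopologicalType) (f : S -> T)
    (a : borel2 T -> R) : continuous f -> measurable_fun setT a ->
  measurable_fun setT (fun z : borel2 S => a (f z.1, f z.2)).
Proof.
by move=> cf ma; exact: (measurableT_comp ma (measurable_map2 (continuous_borel cf))).
Qed.

Section CouplingCompactness.
Context {R : realType} {J : finType} (T : J -> ptopologicalType).
Hypothesis pT : forall j, @polish R (T j).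
Variable xi : forall j, probability (borel (T j)) R.

Let pr j : borel (prod_topology T) -> borel (T j) := fun f => f j.

Lemma measurable_pr j : measurable_fun setT (pr j).
Proof. exact: (continuous_borel (@pr_continuous _ T j)). Qed.

Definition coupling (gamma : probability (borel (prod_topology T)) R) : Prop :=
  forall j, pushes_to gamma (pr j) (xi j).

(** The common form of all integrands: a difference of gauges on two factors, or a gauge minus a
    weighted mean, is a sum of functions each depending on a single coordinate. *)
Definition coordinate_sum (u : forall j, borel2 (T j) -> R)
    (z : borel2 (prod_topology T)) : R :=
  \sum_(j <- enum J) u j (z.1 j, z.2 j).

Local Notation N m f := ('N[m]_2%:E[EFin \o f])%E.
Local Notation sq m := ((m \x m)%E).

Lemma measurable_coordinate j (u : borel2 (T j) -> R) :
  measurable_fun setT u ->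
  measurable_fun setT (fun z : borel2 (prod_topology T) => u (z.1 j, z.2 j)).
Proof. exact: measurable_pullback (@pr_continuous _ T j). Qed.

Lemma measurable_coordinate_sum u : (forall j, measurable_fun setT (u j)) ->
  measurable_fun setT (coordinate_sum u).
Proof. by move=> mu_; apply: measurable_sum => j; exact: measurable_coordinate. Qed.

Lemma coupling_L2norm gamma j (u : borel2 (T j) -> R) : coupling gamma ->
  measurable_fun setT u -> N (sq gamma) (fun z => u (z.1 j, z.2 j)) = N (sq (xi j)) u.
Proof. by move=> cg mu_; exact: (pushes_Lnorm (@measurable_pr j) (cg j) mu_). Qed.

(** The bound sees only the marginals, so it is uniform over all couplings. *)
Lemma coordinate_sum_norm gamma u : coupling gamma ->
  (forall j, measurable_fun setT (u j)) ->
  (N (sq gamma) (coordinate_sum u) <= \sum_(j <- enum J) N (sq (xi j)) (u j))%E.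
Proof.
move=> cg mu_.
have := L2norm_sum (sq gamma) (enum J) (fun j => measurable_coordinate (mu_ j)).
by move=> /le_trans; apply; apply: lee_sum => j _; rewrite coupling_L2norm.
Qed.

Lemma coordinate_sum_finite gamma u : coupling gamma ->
  (forall j, measurable_fun setT (u j)) -> (forall j, N (sq (xi j)) (u j) < +oo)%E ->
  (N (sq gamma) (coordinate_sum u) < +oo)%E.
Proof.
move=> cg mu_ Nu; apply: le_lt_trans (coordinate_sum_norm cg mu_) _.
by apply: lte_sum_pinfty => j _.
Qed.

Let boxes : set (set (borel (prod_topology T))) :=
  [set B | exists2 A : forall j, set (borel (T j)),
    forall j, measurable (A j) & B = box A].

Let boxes_measurable : boxes `<=` measurable.
Proof. by move=> _ [A mA ->]; exact: box_borel. Qed.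

Let boxesI : setI_closed boxes.
Proof.
move=> _ _ [A mA ->] [B mB ->]; exists (fun j => A j `&` B j).
  by move=> j; exact: measurableI.
by apply/seteqP; split => [f [Af Bf] j|f ABf]; split => // j; have [] := ABf j.
Qed.

Let preim_box j (A : set (borel (T j))) : measurable A -> boxes (pr j @^-1` A).
Proof.
move=> mA; pose B : forall i, set (borel (T i)) :=
  @dfwith J (fun i => set (borel (T i))) (fun=> setT) j A.
exists B; first by move=> i; rewrite /B; case: dfwithP.
apply/seteqP; split => [f Af i|f /(_ j)]; first by rewrite /B; case: dfwithP.
by rewrite /B dfwithin.
Qed.

Let boxesT : boxes setT.
Proof. by exists (fun=> setT) => //; apply/seteqP; split. Qed.

Let coordinate_simple j (s : borel2 (T j) -> R) : rect_simple measurable s ->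
  rect_simple boxes (fun z : borel2 (prod_topology T) =>
    s (z.1 j, z.2 j)).
Proof.
elim=> [A B mA mB|a f g _ IHf _ IHg].
  exact: (rect_simple_indic R (preim_box mA) (preim_box mB)).
exact: rect_simple_lin.
Qed.

Let coordinate_sum_simple (s : forall j, borel2 (T j) -> R) :
  (forall j, rect_simple measurable (s j)) ->
  rect_simple boxes (coordinate_sum s).
Proof.
move=> ss; rewrite /coordinate_sum; elim: (enum J) => [|j r IH].
  have := @rect_simple0 R _ boxes _ boxesT; congr rect_simple; apply/funext => z.
  by rewrite big_nil.
have := rect_simple_lin 1 (coordinate_simple (ss j)) IH.
by congr rect_simple; apply/funext => z; rewrite mul1r big_cons.
Qed.

(** Each [u j] is replaced by a simple function, at a cost independent of the coupling; the norms of
    simple sums converge because the masses of boxes do. A single limit law serves all [u], so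
    objective and constraints can be passed to the limit together. *)
Lemma coupling_compact (gam : nat -> probability (borel (prod_topology T)) R) :
  (forall n, coupling (gam n)) ->
  exists U : set_system nat, [/\ UltraFilter U, \oo `<=` U &
  exists2 gamma, coupling gamma & forall u, (forall j, measurable_fun setT (u j)) ->
    (forall j, N (sq (xi j)) (u j) < +oo)%E ->
    fine (N (sq (gam n)) (coordinate_sum u)) @[n --> U] -->
    fine (N (sq gamma) (coordinate_sum u))].
Proof.
move=> cgam.
have [U [UU ooU]] := ultraFilterLemma (@eventually_filter).
have UP : ProperFilter U by exact: ultra_proper.
exists U; split => //.
have /choice[c hc] := fun n => content_of_probability (gam n).
pose L := ultralimit_content c (UU := UU).
have Lxi j (A : set (borel (T j))) : measurable A -> (L (pr j @^-1` A))%:E = xi j A.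
  move=> mA; rewrite -[RHS]fineK ?fin_num_measure//; congr EFin.
  apply: ultra_lim_eq; apply: (@filterS _ U _ setT); last exact: filterT.
  have mprA : measurable (pr j @^-1` A).
    by rewrite -[X in measurable X]setTI; exact: measurable_pr.
  move=> n _ /=; apply: EFin_inj; rewrite hc// -(cgam n j A mA).
  by rewrite /pushforward fineK// fin_num_measure.
have [gamma hgamma] := box_content_extension pT Lxi.
have boxE B : boxes B -> fine (gamma B) = L B by move=> [A mA ->]; rewrite hgamma.
have cbox B : boxes B -> fine (gam n B) @[n --> U] --> fine (gamma B).
  move=> bB; rewrite boxE//.
  have -> : (fun n => fine (gam n B)) = (fun n => c n B).
    by apply/funext => n; rewrite -hc//; exact: boxes_measurable.
  exact: ultralimit_content_cvg.
have cgamma : coupling gamma.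
  move=> j A mA; have bA := preim_box mA.
  transitivity ((L (pr j @^-1` A))%:E); last exact: Lxi.
  rewrite -boxE// /pushforward fineK// fin_num_measure//.
  exact: boxes_measurable.
exists gamma => // u mu_ Nu.
apply/cvgrPdist_le => e e0.
have d0 : 0 < e / 3%:R / #|J|.+1%:R by rewrite !divr_gt0.
have /dependent_function_choice[s hs] : forall j, exists s, rect_simple measurable s /\
    (N (sq (xi j)) (fun z => u j z - s z)%R <= (e / 3%:R / #|J|.+1%:R)%:E)%E.
  by move=> j; have [_ /(_ _ d0)[s ss us]] := L2_dense (mu_ j) (Nu j); exists s.
have ms j : measurable_fun setT (s j) by exact: simple_measurable (hs j).1.
have Ns j : (N (sq (xi j)) (s j) < +oo)%E.
  have [_ [M hM]] := rect_simple_bounded (@subset_refl _ _) (hs j).1.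
  exact: L2norm_bounded hM.
(* This holds for every coupling, hence for all [gam n] and for the limit with the same [s]. *)
have close g : coupling g ->
    `|fine (N (sq g) (coordinate_sum u)) -
      fine (N (sq g) (coordinate_sum s))| <= e / 3%:R.
  move=> cg; apply: L2norm_dist.
  - exact: measurable_coordinate_sum.
  - exact: measurable_coordinate_sum.
  - exact: coordinate_sum_finite.
  - exact: coordinate_sum_finite.
  rewrite (eq_Lnorm _ _
    (g := EFin \o coordinate_sum (fun j z => u j z - s j z))); last first.
    by move=> z /=; congr EFin; rewrite /coordinate_sum -sumrB.
  apply: le_trans (coordinate_sum_norm cg _) _.
    by move=> j; exact: measurable_funB.
  apply: (@le_trans _ _ (\sum_(j <- enum J) (e / 3%:R / #|J|.+1%:R)%:E)%E).
    by apply: lee_sum => j _; exact: (hs j).2.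
  rewrite sumEFin lee_fin big_enum sumr_const -(mulr_natr (_ / _)) -mulrA.
  by rewrite ger_pMr ?divr_gt0// mulrC ler_pdivrMr// mul1r ler_nat.
have e3 : 0 < e / 3%:R by rewrite divr_gt0.
have := simple_L2norm_cvg boxes_measurable boxesI cbox
  (coordinate_sum_simple (fun j => (hs j).1)).
move=> /(_ UP)/cvgrPdist_le/(_ _ e3).
apply: filterS => n hn.
exact: dist_le_thirds (close _ cgamma) (close _ (cgam n)) hn.
Qed.

End CouplingCompactness.

(** * Plans between gauged measure spaces *)

Lemma fst_continuous (X Y : topologicalType) : continuous (fst : X * Y -> X).
Proof. by move=> z; exact: cvg_fst. Qed.

Lemma snd_continuous (X Y : topologicalType) : continuous (snd : X * Y -> Y).
Proof. by move=> z; exact: cvg_snd. Qed.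

Lemma pair_continuous (S X Y : topologicalType) (f : S -> X) (g : S -> Y) :
  continuous f -> continuous g -> continuous (fun s => (f s, g s)).
Proof. by move=> cf cg s; apply: cvg_pair; [exact: cf|exact: cg]. Qed.

Lemma prod_continuous (S : topologicalType) (J : finType) (T : J -> ptopologicalType)
    (f : S -> prod_topology T) :
  (forall j, continuous (fun s => f s j)) -> continuous f.
Proof.
move=> cf s A /box_nbhs[B [nB BA]].
have : \forall t \near s, forall j, B j (f t j).
  by apply: filter_forall => j; exact: (cf j s (B j) (nB j)).
by apply: filterS => t; exact: BA.
Qed.

Notation glued W Z :=
  (prod_topology (glue_space Z (fun j => W j : ptopologicalType))).

Section Plans.
Context {R : realType}.
Implicit Types A B C X Y Z : gmSpace R.

Local Notation N m f := ('N[m]_2%:E[EFin \o f%R])%E.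
Local Notation sq m := ((m \x m)%E).

Lemma gauge_norm (T : ptopologicalType) (mu : probability (borel T) R) g :
  is_gauge mu g -> (N (sq mu) g < +oo)%E.
Proof. by move=> [gL _]; move: gL; rewrite inE => /andP[_]; rewrite inE. Qed.

Lemma measurable_gm_gauge X : measurable_fun setT (@gm_gauge R X).
Proof. exact: gauge_measurable (gm_gaugeP X). Qed.

Section PlanOf.
Variables (S : ptopologicalType) (mu : probability (borel S) R) (X Y : gmSpace R).
Variables (f : S -> X) (g : S -> Y).
Hypotheses (cf : continuous f) (cg : continuous g).
Hypotheses (hf : pushes_to mu (f : borel S -> borel X) (gm_law X))
  (hg : pushes_to mu (g : borel S -> borel Y) (gm_law Y)).

Let law := push_prob mu (continuous_borel (pair_continuous cf cg)).

Let law_fst : pushes_to law (fst : borel (X * Y)%type -> borel X) (gm_law X).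
Proof. by move=> A mA; exact: hf. Qed.

Let law_snd : pushes_to law (snd : borel (X * Y)%type -> borel Y) (gm_law Y).
Proof. by move=> A mA; exact: hg. Qed.

Definition plan_of : plan X Y := Plan law_fst law_snd.

Lemma plan_of_pushes : pushes_to mu
  ((fun s => (f s, g s)) : borel S -> borel (X * Y)%type) plan_of.
Proof. by []. Qed.

End PlanOf.

Lemma measurable_diff (S : ptopologicalType) (T U : ptopologicalType)
    (f : S -> T) (g : S -> U) (a : borel2 T -> R) (b : borel2 U -> R) :
  continuous f -> continuous g -> measurable_fun setT a -> measurable_fun setT b ->
  measurable_fun setT (fun z : borel2 S =>
    a (f z.1, f z.2) - b (g z.1, g z.2)).
Proof.
move=> cf cg ma mb; apply: measurable_funB.
  exact: (measurable_pullback cf ma).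
exact: (measurable_pullback cg mb).
Qed.

(** Costs of different plans become norms on one probability space, where they are compared by the
    triangle inequality. *)
Lemma L2_cost_push (S : ptopologicalType) (mu : probability (borel S) R) X Y
    (f : S -> X) (g : S -> Y) (pi : plan X Y) a b :
  continuous f -> continuous g ->
  pushes_to mu ((fun s => (f s, g s)) : borel S -> borel (X * Y)%type) pi ->
  measurable_fun setT a -> measurable_fun setT b ->
  L2_cost pi a b = N (sq mu) (fun z => a (f z.1, f z.2) - b (g z.1, g z.2)).
Proof.
move=> cf cg mupi ma mb.
rewrite /L2_cost -(pushes_Lnorm (continuous_borel (pair_continuous cf cg)) mupi)//.
exact: (measurable_diff (@fst_continuous X Y) (@snd_continuous X Y)).
Qed.

Lemma plan_pushes X Y (pi : plan X Y) : pushes_to pi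
  ((fun s => (s.1, s.2)) : borel (X * Y)%type -> borel (X * Y)%type) pi.
Proof.
move=> A mA; rewrite /pushforward; congr (pi _).
by apply/seteqP; split => -[x y].
Qed.

Definition plan_swap X Y (pi : plan X Y) : plan Y X :=
  plan_of (@snd_continuous X Y) (@fst_continuous X Y) (plan_snd pi) (plan_fst pi).

Lemma plan_swap_cost X Y (pi : plan X Y) a b :
  measurable_fun setT a -> measurable_fun setT b ->
  L2_cost (plan_swap pi) b a = L2_cost pi a b.
Proof.
move=> ma mb.
rewrite (L2_cost_push (@snd_continuous X Y) (@fst_continuous X Y)
  (plan_of_pushes _ _ _ _))//.
by rewrite L2normC.
Qed.

Lemma id_pushes X :
  pushes_to (gm_law X) (@idfun X : borel X -> borel X) (gm_law X).
Proof. by []. Qed.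

Lemma id_continuous (T : topologicalType) : continuous (@idfun T).
Proof. by move=> z; exact: cvg_id. Qed.

Definition diagonal_plan X : plan X X :=
  plan_of (@id_continuous X) (@id_continuous X) (@id_pushes X) (@id_pushes X).

Lemma L2norm0 d (S : measurableType d) (mu : probability S R) (f : S -> R) :
  (forall z, f z = 0) -> N mu f = 0%E.
Proof.
by move=> f0; rewrite (eq_Lnorm _ _ (g := cst 0%E)) ?Lnorm0// => z /=; rewrite f0.
Qed.

Lemma diagonal_cost X a : measurable_fun setT a -> L2_cost (diagonal_plan X) a a = 0%E.
Proof.
move=> ma; rewrite (L2_cost_push (@id_continuous X) (@id_continuous X)
  (plan_of_pushes _ _ _ _))//.
by apply: L2norm0 => z; rewrite subrr.
Qed.

(** [gluing_exists] wants the shared factor first, hence the swaps; its equality on rectangles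
    extends to all Borel sets by [borel_pair_eq]. *)
Lemma glue_plans (J : finType) (j0 : J) (W : J -> gmSpace R) Z
    (tau : forall j, plan (W j) Z) :
  exists gamma : probability (borel (glued W Z)) R,
    forall j, pushes_to gamma
      ((fun w => (w (Some j), w None)) :
         borel (glued W Z) ->
         borel (W j * Z)%type) (tau j).
Proof.
have [gamma hg] := gluing_exists j0 (gm_polish Z) (fun j => gm_polish (W j))
  (fun j => plan_fst (plan_swap (tau j))).
exists gamma => j.
have cj : continuous (fun w : glued W Z =>
    (w (Some j), w None) : (W j * Z)%type).
  apply: (@pair_continuous _ (W j) Z).
    exact: (@pr_continuous _ (glue_space Z (fun j => W j : ptopologicalType)) (Some j)).
  exact: (@pr_continuous _ (glue_space Z (fun j => W j : ptopologicalType)) None).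
move=> A mA.
apply: (@borel_pair_eq R (W j) Z (push_prob gamma (continuous_borel cj)) (tau j)
  (gm_polish _) (gm_polish _) _ A mA) => B C mB mC.
transitivity (plan_swap (tau j) (C `*` B)); last first.
  rewrite /plan_swap /= /push_prob /distribution /= /pushforward.
  by congr (plan_law (tau j) _); apply/seteqP; split => -[x y] /= [].
by rewrite -hg//; congr (gamma _); apply/seteqP; split => f [].
Qed.

(** Gluing along [B] puts the three functions on one space. The plan [rho] does not depend on them,
    so the same one yields both optimality, from the gauges, and a bound for tangents. *)
Lemma plan_trans A B C (sigma : plan A B) (tau : plan B C) : exists rho : plan A C,
  forall a b c, measurable_fun setT a -> measurable_fun setT b ->
    measurable_fun setT c ->
    (L2_cost rho a c <= L2_cost sigma a b + L2_cost tau b c)%E.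
Proof.
pose W (j : bool) := if j then A else C.
pose t (j : bool) : plan (W j) B :=
  match j return plan (W j) B with true => sigma | false => plan_swap tau end.
have [gamma hg] := glue_plans true t.
pose T := glue_space B (fun j => W j : ptopologicalType).
have cA : continuous (fun w : prod_topology T => w (Some true) : A).
  exact: (@pr_continuous _ T (Some true)).
have cB : continuous (fun w : prod_topology T => w None : B).
  exact: (@pr_continuous _ T None).
have cC : continuous (fun w : prod_topology T => w (Some false) : C).
  exact: (@pr_continuous _ T (Some false)).
have hA : pushes_to gamma
    ((fun w => w (Some true)) : borel (prod_topology T) -> borel A) (gm_law A).
  apply: pushes_to_comp (hg true) (plan_fst sigma).
  exact: (continuous_borel (@fst_continuous A B)).
have hC : pushes_to gamma
    ((fun w => w (Some false)) : borel (prod_topology T) -> borel C) (gm_law C).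
  apply: pushes_to_comp (hg false) (plan_fst (plan_swap tau)).
  exact: (continuous_borel (@fst_continuous C B)).
exists (plan_of cA cC hA hC) => a b c ma mb mc.
rewrite (L2_cost_push cA cC (plan_of_pushes _ _ _ _))//.
rewrite (L2_cost_push cA cB (hg true))//.
rewrite -(plan_swap_cost tau)// (L2_cost_push cC cB (hg false))// [X in (_ + X)%E]L2normC.
apply: L2norm_triangle.
- exact: (measurable_pullback cA ma).
- exact: (measurable_pullback cB mb).
- exact: (measurable_pullback cC mc).
Qed.

Lemma L2_cost_finite X Y (pi : plan X Y) a b : is_gauge (gm_law X) a ->
  is_gauge (gm_law Y) b -> (L2_cost pi a b < +oo)%E.
Proof.
move=> ga gb; have ma := gauge_measurable ga; have mb := gauge_measurable gb.
have m1 : measurable_fun setT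
    (fun z : borel2 (X * Y)%type => a (z.1.1, z.2.1)).
  exact: (measurable_pullback (@fst_continuous X Y) ma).
have m2 : measurable_fun setT
    (fun z : borel2 (X * Y)%type => b (z.1.2, z.2.2)).
  exact: (measurable_pullback (@snd_continuous X Y) mb).
have m3 : measurable_fun setT
    (fun z : borel2 (X * Y)%type => - b (z.1.2, z.2.2)).
  exact: measurableT_comp.
apply: (le_lt_trans (L2normD (sq pi) m1 m3)).
apply: lte_add_pinfty.
  rewrite (pushes_Lnorm (continuous_borel (@fst_continuous X Y)) (plan_fst pi) ma).
  exact: gauge_norm.
rewrite L2normN (pushes_Lnorm (continuous_borel (@snd_continuous X Y)) (plan_snd pi) mb).
exact: gauge_norm.
Qed.

End Plans.

Lemma ultra_lim_le (R : realType) (U : set_system nat) (x : nat -> R) (l m : R) :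
  ProperFilter U -> \oo `<=` U -> (forall n, x n <= m + n.+1%:R^-1) ->
  x n @[n --> U] --> l -> l <= m.
Proof.
move=> UP ooU xm xl; apply/ler_addgt0Pr => e e0.
rewrite -(cvg_lim _ xl)//; apply: limr_le; first by apply: cvgP; exact: xl.
apply: ooU; have [n _ hn] := near_infty_natSinv_lt (PosNum e0).
by exists n => // k /hn /= kn; apply: le_trans (xm k) _; rewrite lerD2l ltW.
Qed.

Lemma ereal_inf_adherent_seq (R : realType) (S : set (\bar R)) (m : R) :
  ereal_inf S = m%:E ->
  forall n, exists2 x, S x & (x <= (m + n.+1%:R^-1)%:E)%E.
Proof.
move=> Sm n; have n0 : 0 < n.+1%:R^-1 :> R by rewrite invr_gt0.
have [|x Sx hx] := @lb_ereal_inf_adherent R S _ n0; first by rewrite Sm.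
by exists x => //; rewrite EFinD -Sm ltW.
Qed.

(** * Attainment of the infima over plans, and zero-cost plans *)

Section OptimalPlans.
Context {R : realType}.
Implicit Types A B C X Y Z : gmSpace R.

Local Notation N m f := ('N[m]_2%:E[EFin \o f%R])%E.
Local Notation sq m := ((m \x m)%E).

(** [coupling_compact] for two factors indexed by [bool], with [- b] on the second so that the cost
    is the norm of a coordinate sum. *)
Lemma plan_compact X Y (pi_ : nat -> plan X Y) :
  exists U : set_system nat, [/\ ProperFilter U, \oo `<=` U &
  exists pi : plan X Y, forall a b, is_gauge (gm_law X) a -> is_gauge (gm_law Y) b ->
    fine (L2_cost (pi_ n) a b) @[n --> U] --> fine (L2_cost pi a b)].
Proof.
pose T (j : bool) : ptopologicalType := if j then X else Y.
pose xi (j : bool) : probability (borel (T j)) R :=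
  match j return probability (borel (T j)) R with
  true => gm_law X | false => gm_law Y end.
have pT j : @polish R (T j) by case: j; exact: gm_polish.
pose f (p : X * Y) : prod_topology T :=
  fun j => match j return T j with true => p.1 | false => p.2 end.
have cf : continuous f.
  by apply: prod_continuous => -[]; [exact: fst_continuous|exact: snd_continuous].
pose gam n := push_prob (pi_ n) (continuous_borel cf).
have cgam n : coupling xi (gam n).
  by move=> [] D mD; [exact: (plan_fst (pi_ n))|exact: (plan_snd (pi_ n))].
have [U [UU ooU [gamma cgamma hU]]] := coupling_compact pT cgam.
exists U; split => //; first exact: ultra_proper.
have cX : continuous (fun w : prod_topology T => w true : X).
  exact: (@pr_continuous _ T true).
have cY : continuous (fun w : prod_topology T => w false : Y).
  exact: (@pr_continuous _ T false).
exists (plan_of cX cY (cgamma true) (cgamma false)) => a b ga gb.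
have ma := gauge_measurable ga; have mb := gauge_measurable gb.
pose u (j : bool) : borel2 (T j) -> R :=
  match j return borel2 (T j) -> R with
  true => a | false => fun z => - b z end.
have uE z : coordinate_sum u z = a (z.1 true, z.2 true) - b (z.1 false, z.2 false).
  by rewrite /coordinate_sum big_enum big_bool.
have -> : L2_cost (plan_of cX cY (cgamma true) (cgamma false)) a b =
    N (sq gamma) (coordinate_sum u).
  rewrite (L2_cost_push cX cY (plan_of_pushes _ _ _ _))//.
  by apply: eq_Lnorm => z /=; rewrite uE.
have -> : (fun n => fine (L2_cost (pi_ n) a b)) =
    (fun n => fine (N (sq (gam n)) (coordinate_sum u))).
  apply/funext => n; congr fine.
  have h : pushes_to (gam n) ((fun w => (w true, w false)) :
      borel (prod_topology T) -> borel (X * Y)%type) (pi_ n).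
    exact: plan_pushes.
  rewrite (L2_cost_push cX cY h)//.
  by apply: eq_Lnorm => z /=; rewrite uE.
apply: hU => -[] //=.
- exact: measurableT_comp.
- exact: gauge_norm ga.
- by rewrite L2normN; exact: gauge_norm gb.
Qed.

Lemma FGW_ge0 X Y (pi : plan X Y) : (0 <= FGW pi)%E.
Proof. exact: Lnorm_ge0. Qed.

Lemma GW_ge0 X Y : (0 <= GW X Y)%E.
Proof. by apply: le_ereal_inf_tmp => _ [pi _ <-]; exact: FGW_ge0. Qed.

Lemma GW_le X Y (pi : plan X Y) : (GW X Y <= FGW pi)%E.
Proof. by apply: ereal_inf_lbound; exists pi. Qed.

Let cost_fin X Y (pi : plan X Y) a b : is_gauge (gm_law X) a ->
  is_gauge (gm_law Y) b -> L2_cost pi a b \is a fin_num.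
Proof. by move=> ga gb; rewrite ge0_fin_numE ?Lnorm_ge0 ?L2_cost_finite. Qed.

Lemma zero_GW_plan X Y : GW X Y = 0%E -> exists pi : plan X Y, FGW pi = 0%E.
Proof.
move=> XY0; have gX := gm_gaugeP X; have gY := gm_gaugeP Y.
have /choice[pi_ hpi] : forall n, exists pi : plan X Y, (FGW pi <= (0 + n.+1%:R^-1)%:E)%E.
  by move=> n; have [_ [pi _ <-] h] := ereal_inf_adherent_seq XY0 n; exists pi.
have [U [UP ooU [pi hU]]] := plan_compact pi_.
exists pi; apply/eqP; rewrite eq_le FGW_ge0 andbT.
rewrite -[FGW pi]fineK ?cost_fin// lee_fin.
apply: (ultra_lim_le UP ooU _ (hU _ _ gX gY)) => n.
by rewrite -lee_fin fineK ?cost_fin//; exact: hpi.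
Qed.

(** The limit of a minimising sequence of optimal plans works for the gauges and for [a], [b] at
    once: its distortion is a limit of zeros, so it stays optimal, and its cost is at most the
    infimum. *)
Lemma L2_cost_min X Y a b : is_gauge (gm_law X) a -> is_gauge (gm_law Y) b ->
  GW X Y = 0%E ->
  exists2 pi : plan X Y, optimal pi &
    (L2_cost pi a b <= ereal_inf [set L2_cost tau a b | tau in @optimal R X Y])%E.
Proof.
move=> ga gb XY0; have gX := gm_gaugeP X; have gY := gm_gaugeP Y.
have [pi0 hpi0] := zero_GW_plan XY0.
set S := [set L2_cost tau a b | tau in @optimal R X Y].
have Sfin : ereal_inf S \is a fin_num.
  rewrite ge0_fin_numE; last by apply: le_ereal_inf_tmp => _ [pi _ <-]; exact: Lnorm_ge0.
  apply: le_lt_trans (L2_cost_finite pi0 ga gb); apply: ereal_inf_lbound.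
  by exists pi0 => //; rewrite /optimal /= hpi0 XY0.
have /esym SE := fineK Sfin.
have /choice[pi_ hpi] : forall n, exists pi : plan X Y, optimal pi /\
    (L2_cost pi a b <= (fine (ereal_inf S) + n.+1%:R^-1)%:E)%E.
  by move=> n; have [_ [pi opi <-] h] := ereal_inf_adherent_seq SE n; exists pi.
have [U [UP ooU [pi hU]]] := plan_compact pi_.
have pi0' : FGW pi = 0%E.
  apply/eqP; rewrite eq_le FGW_ge0 andbT.
  rewrite -[FGW pi]fineK ?cost_fin// lee_fin.
  apply: (ultra_lim_le UP ooU _ (hU _ _ gX gY)) => n.
  have [opi _] := hpi n.
  by rewrite -lee_fin fineK ?cost_fin// [leLHS]opi XY0 lee_fin add0r.
exists pi; first by rewrite /optimal /= pi0' XY0.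
rewrite SE -[L2_cost pi a b]fineK ?cost_fin// lee_fin.
apply: (ultra_lim_le UP ooU _ (hU _ _ ga gb)) => n.
by rewrite -lee_fin fineK ?cost_fin//; exact: (hpi n).2.
Qed.

Lemma FGW_trans X Y Z (sigma : plan X Y) (tau : plan Y Z) :
  FGW sigma = 0%E -> FGW tau = 0%E -> exists rho : plan X Z, FGW rho = 0%E /\
  forall a b c, measurable_fun setT a -> measurable_fun setT b -> measurable_fun setT c ->
    (L2_cost rho a c <= L2_cost sigma a b + L2_cost tau b c)%E.
Proof.
move=> s0 t0; have [rho hrho] := plan_trans sigma tau.
exists rho; split => //; apply/eqP; rewrite eq_le FGW_ge0 andbT.
have := hrho _ _ _ (@measurable_gm_gauge _ X) (@measurable_gm_gauge _ Y)
  (@measurable_gm_gauge _ Z).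
by rewrite -/(FGW _) -/(FGW _) -/(FGW _) s0 t0 adde0.
Qed.

Lemma FGW_swap X Y (pi : plan X Y) : FGW (plan_swap pi) = FGW pi.
Proof. by apply: plan_swap_cost; exact: measurable_gm_gauge. Qed.

Lemma gm_class_GW Y A B : gm_class Y A -> gm_class Y B -> GW A B = 0%E.
Proof.
move=> /zero_GW_plan[p hp] /zero_GW_plan[q hq].
have [|rho [hrho _]] := @FGW_trans _ _ _ (plan_swap p) q _ hq; first by rewrite FGW_swap.
by apply/eqP; rewrite eq_le GW_ge0 andbT -hrho GW_le.
Qed.

(** * The tangent metric in terms of given representatives *)

Section Tangents.
Variable Y : gmSpace R.
Local Notation tg := (tangent (gm_class Y)).
Local Notation tgf f := (@tg_fun R (gm_class Y) f).

Lemma optimalP A B (pi : plan A B) : gm_class Y A -> gm_class Y B ->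
  optimal pi <-> FGW pi = 0%E.
Proof. by move=> cA cB; rewrite /optimal /= (gm_class_GW cA cB). Qed.

Let tg_measurable (f : tg) : measurable_fun setT (tgf f).
Proof. exact: gauge_measurable (tg_funP f). Qed.

Lemma tg_equiv_cost (f f' : tg) : tg_equiv f f' ->
  exists tau : plan (tg_base f) (tg_base f'),
    FGW tau = 0%E /\ L2_cost tau (tgf f) (tgf f') = 0%E.
Proof.
move=> [tau otau ae]; exists tau; split.
  by apply/optimalP => //; exact: tg_baseP.
have md := measurable_diff (@fst_continuous (tg_base f) (tg_base f'))
  (@snd_continuous (tg_base f) (tg_base f')) (@tg_measurable f) (@tg_measurable f').
apply/eqP; rewrite eq_le Lnorm_ge0 andbT; apply: L2norm_le => //.
rewrite expr0n /= [leLHS](_ : _ = 0%E)// -(integral0 (sq tau) setT).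
apply: ae_eq_integral => //.
- by apply/measurable_EFinP; exact: measurable_sqr.
- by apply: filterS ae => z hz _ /=; rewrite hz subrr expr0n.
Qed.

Lemma tg_equiv_refl (f : tg) : tg_equiv f f.
Proof.
exists (diagonal_plan (tg_base f)).
  apply/optimalP; [exact: tg_baseP..|].
  by apply: diagonal_cost; exact: measurable_gm_gauge.
have mf := @tg_measurable f.
have md := measurable_diff (@fst_continuous (tg_base f) (tg_base f))
  (@snd_continuous (tg_base f) (tg_base f)) mf mf.
have : L2_cost (diagonal_plan (tg_base f)) (tgf f) (tgf f) = 0%E by exact: diagonal_cost.
have p0 : (0 < 2%:E :> \bar R)%E by rewrite lte_fin.
move=> /(Lnorm_eq0_eq0 ((measurable_EFinP _ _).2 md) p0).
apply: filterS => z h; apply/eqP; rewrite -subr_eq0; apply/eqP.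
exact: EFin_inj (h Logic.I).
Qed.

Lemma tg_equiv_trepr (f : tg) : tg_equiv f (trepr (tclass f)).
Proof.
have : tg_equiv f = tg_equiv (trepr (tclass f)).
  exact: projT2 (cid (projT2 (tclass f))).
by move=> ->; exact: tg_equiv_refl.
Qed.

Lemma tdist_ge0 (F F' : tspace (gm_class Y)) : (0 <= tdist F F')%E.
Proof. by apply: le_ereal_inf_tmp => _ [tau _ <-]; exact: Lnorm_ge0. Qed.

(** [tdist] is evaluated at chosen representatives; composing [tau] with zero-cost equivalences on
    both sides carries it there without increasing the cost. *)
Lemma tdist_le (f f' : tg) (tau : plan (tg_base f) (tg_base f')) : FGW tau = 0%E ->
  (tdist (tclass f) (tclass f') <= L2_cost tau (tgf f) (tgf f'))%E.
Proof.
move=> tau0.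
have [p [p0 pc]] := tg_equiv_cost (tg_equiv_trepr f).
have [q [q0 qc]] := tg_equiv_cost (tg_equiv_trepr f').
have [|r [r0 rc]] := @FGW_trans _ _ _ (plan_swap p) tau _ tau0; first by rewrite FGW_swap.
have [s [s0 sc]] := FGW_trans r0 q0.
apply: (@le_trans _ _ (L2_cost s (tgf (trepr (tclass f))) (tgf (trepr (tclass f'))))).
  apply: ereal_inf_lbound; exists s => //.
  by apply/optimalP => //; exact: tg_baseP.
apply: le_trans (sc _ (tgf f') _ _ _ _) _ => //.
rewrite qc adde0; apply: le_trans (rc _ (tgf f) _ _ _ _) _ => //.
by rewrite plan_swap_cost// pc add0e.
Qed.

(** A minimiser exists at the chosen representative of [tclass f]; composition with a zero-cost
    equivalence moves it to [f]. *)
Lemma tdist_attained (f : tg) (F : tspace (gm_class Y)) :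
  exists sigma : plan (tg_base f) (tg_base (trepr F)), FGW sigma = 0%E /\
    (L2_cost sigma (tgf f) (tgf (trepr F)) <= tdist (tclass f) F)%E.
Proof.
have [p [p0 pc]] := tg_equiv_cost (tg_equiv_trepr f).
have cl : GW (tg_base (trepr (tclass f))) (tg_base (trepr F)) = 0%E.
  by apply: gm_class_GW; exact: tg_baseP.
have [tau otau htau] := L2_cost_min (tg_funP (trepr (tclass f))) (tg_funP (trepr F)) cl.
have tau0 : FGW tau = 0%E by rewrite [LHS]otau.
have [s [s0 sc]] := FGW_trans p0 tau0.
exists s; split => //; apply: le_trans (sc _ (tgf (trepr (tclass f))) _ _ _ _) _ => //.
by rewrite pc add0e.
Qed.

End Tangents.
End OptimalPlans.

(** * The tangential barycenter *)

Section WeightedMean.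
Context {R : realType} {n : nat} (rho : 'I_n -> R).
Hypothesis rho_simplex : simplex rho.

(** Expanding around the mean [m], the cross term vanishes as the weights sum to 1, and the excess
    is the square of [m - c]. *)
Lemma weighted_mean_min (a : 'I_n -> R) (c : R) :
  \sum_i rho i * (a i - \sum_k rho k * a k) ^+ 2 <= \sum_i rho i * (a i - c) ^+ 2.
Proof.
have [_ rho1] := rho_simplex; set m := \sum_k rho k * a k.
have e i : rho i * (a i - c) ^+ 2 =
    rho i * (a i - m) ^+ 2 + 2 * (m - c) * (rho i * a i - rho i * m) +
    rho i * (m - c) ^+ 2.
  by ring.
under [leRHS]eq_bigr do rewrite e.
rewrite !big_split/= -mulr_sumr sumrB -!mulr_suml rho1 !mul1r -/m.
rewrite subrr mulr0 addr0.
by rewrite lerDl sqr_ge0.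
Qed.

Context d (S : measurableType d) (mu : probability S R).
Local Notation N f := ('N[mu]_2%:E[EFin \o f%R])%E.

Lemma weighted_mean_L2norm (a : 'I_n -> S -> R) (c : S -> R) :
  (forall i, measurable_fun setT (a i)) -> measurable_fun setT c ->
  (\sum_i (rho i)%:E * N (fun z => a i z - \sum_k rho k * a k z) ^+ 2 <=
   \sum_i (rho i)%:E * N (fun z => a i z - c z) ^+ 2)%E.
Proof.
move=> ma mc; have [rho01 _] := rho_simplex.
have rho0 i : 0 <= rho i by have /andP[] := rho01 i.
have mm : measurable_fun setT (fun z => \sum_k rho k * a k z).
  by apply: measurable_sum => k; exact: measurable_funM.
have sumE (b : S -> R) : measurable_fun setT b ->
    (\sum_i (rho i)%:E * N (fun z => a i z - b z)%R ^+ 2 =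
     \int[mu]_z (\sum_i rho i * (a i z - b z) ^+ 2)%:E)%E.
  move=> mb.
  have msq i : measurable_fun setT (fun z => (a i z - b z) ^+ 2).
    by apply: measurable_sqr; exact: measurable_funB.
  under eq_integral do rewrite -sumEFin.
  rewrite ge0_integral_sum//; last 2 first.
  - by move=> i; apply/measurable_EFinP; exact: measurable_funM.
  - by move=> i z _; rewrite lee_fin mulr_ge0// sqr_ge0.
  apply: eq_bigr => i _; rewrite L2norm_sqr; last exact: measurable_funB.
  rewrite -ge0_integralZl//.
  - by apply/measurable_EFinP.
  - by move=> z _; rewrite lee_fin sqr_ge0.
  - by rewrite lee_fin.
rewrite !sumE//.
have msum (b : S -> R) : measurable_fun setT b ->
    measurable_fun setT (fun z => (\sum_i rho i * (a i z - b z) ^+ 2)%:E).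
  move=> mb; apply/measurable_EFinP; apply: measurable_sum => i.
  by apply: measurable_funM => //; apply: measurable_sqr; exact: measurable_funB.
apply: ge0_le_integral => //.
- by move=> z _; rewrite lee_fin sumr_ge0// => i _; rewrite mulr_ge0// sqr_ge0.
- exact: msum.
- exact: msum.
- by move=> z _; rewrite lee_fin; exact: weighted_mean_min.
Qed.

End WeightedMean.

(** Selects one coordinate by a scalar factor, avoiding a cast along [k = i] when the terms have
    types depending on [k]. *)
Lemma sum_indicator (R : pzRingType) (J : finType) (i : J) (F : J -> R) :
  \sum_(k <- enum J) (k == i)%:R * F k = F i.
Proof.
rewrite big_enum (bigD1 i)//= eqxx mul1r big1 ?addr0// => k /negbTE ->.
by rewrite mul0r.
Qed.

Section Barycenter.
Context {R : realType} {n : nat} (n_gt0 : (0 < n)%N).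
Variables (X : 'I_n -> gmSpace R) (Y : gmSpace R) (rho : 'I_n -> R).
Hypothesis rho_simplex : simplex rho.
Variable pi : forall i, plan Y (X i).
Hypothesis pi_opt : forall i, optimal (pi i).

Local Notation N m f := ('N[m]_2%:E[EFin \o f%R])%E.
Local Notation sq m := ((m \x m)%E).

Let i0 : 'I_n := Ordinal n_gt0.
Let r i : tangent (gm_class Y) := residual (pi i).
Let W i : gmSpace R := tg_base (r i).
Let T i : ptopologicalType := W i.
Let Om : ptopologicalType := prod_topology T.
Let g i : borel2 (W i) -> R :=
  fun z => @gm_gauge R (X i) (z.1.2, z.2.2).
Let h i : borel2 (W i) -> R := @gm_gauge R (W i).
Arguments g : clear implicits.
Arguments h : clear implicits.

Let g_gauge i : is_gauge (gm_law (W i)) (g i).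
Proof.
exact: (gauge_comp (@snd_continuous Y (X i)) (plan_snd (pi i)) (gm_gaugeP (X i))).
Qed.

Let h_gauge i : is_gauge (gm_law (W i)) (h i).
Proof. exact: gm_gaugeP. Qed.

Let mg i : measurable_fun setT (g i). Proof. exact: gauge_measurable (g_gauge i). Qed.
Let mh i : measurable_fun setT (h i). Proof. exact: gauge_measurable (h_gauge i). Qed.

(* As coordinate sums, these are h_i - h_j and g_i - m_rho. *)
Let uh i j k : borel2 (T k) -> R :=
  fun z => ((k == i)%:R - (k == j)%:R) * h k z.
Let ug i k : borel2 (T k) -> R :=
  fun z => ((k == i)%:R - rho k) * g k z.
Arguments uh : clear implicits.
Arguments ug : clear implicits.

Let uhE i j z : coordinate_sum (uh i j) z =
  h i (z.1 i, z.2 i) - h j (z.1 j, z.2 j).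
Proof.
rewrite /coordinate_sum /uh; under eq_bigr do rewrite mulrBl.
by rewrite sumrB (sum_indicator i (fun k => h k (z.1 k, z.2 k)))
  (sum_indicator j (fun k => h k (z.1 k, z.2 k))).
Qed.

Let ugE i z : coordinate_sum (ug i) z =
  g i (z.1 i, z.2 i) - \sum_k rho k * g k (z.1 k, z.2 k).
Proof.
rewrite /coordinate_sum /ug; under eq_bigr do rewrite mulrBl.
by rewrite sumrB (sum_indicator i (fun k => g k (z.1 k, z.2 k))) [in X in _ - X]big_enum.
Qed.

Definition admissible (gamma : probability (borel Om) R) : Prop :=
  coupling (fun i => gm_law (W i)) gamma /\
  forall i j, N (sq gamma) (coordinate_sum (uh i j)) = 0%E.

Definition dispersion (gamma : probability (borel Om) R) : R :=
  \sum_i rho i * fine (N (sq gamma) (coordinate_sum (ug i))) ^+ 2.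

Let gauge_scale i (c : R) (f : borel2 (T i) -> R) :
  is_gauge (gm_law (W i)) f -> is_gauge (gm_law (W i)) (fun z => c * f z).
Proof.
move=> gf; have := gauge_lin c gf (gauge0 (gm_law (W i))).
by congr is_gauge; apply/funext => z; rewrite addr0.
Qed.

Let ug_gauge i k : is_gauge (gm_law (W k)) (ug i k).
Proof. exact: gauge_scale. Qed.

Let uh_gauge i j k : is_gauge (gm_law (W k)) (uh i j k).
Proof. exact: gauge_scale. Qed.

Let ug_fin gamma i : coupling (fun i => gm_law (W i)) gamma ->
  N (sq gamma) (coordinate_sum (ug i)) \is a fin_num.
Proof.
move=> cg; rewrite ge0_fin_numE ?Lnorm_ge0//; apply: (coordinate_sum_finite cg) => k.
  exact: gauge_measurable (ug_gauge i k).
exact: gauge_norm (ug_gauge i k).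
Qed.

Let uh_fin gamma i j : coupling (fun i => gm_law (W i)) gamma ->
  N (sq gamma) (coordinate_sum (uh i j)) \is a fin_num.
Proof.
move=> cg; rewrite ge0_fin_numE ?Lnorm_ge0//; apply: (coordinate_sum_finite cg) => k.
  exact: gauge_measurable (uh_gauge i j k).
exact: gauge_norm (uh_gauge i j k).
Qed.

Lemma dispersionE gamma : coupling (fun i => gm_law (W i)) gamma ->
  ((dispersion gamma)%:E =
   \sum_i (rho i)%:E * N (sq gamma) (coordinate_sum (ug i)) ^+ 2)%E.
Proof.
move=> cg; rewrite /dispersion -sumEFin; apply: eq_bigr => i _.
by rewrite EFinM EFin_expe fineK// ug_fin.
Qed.

Let rho_ge0 i : 0 <= rho i.
Proof. by have [/(_ i)/andP[]] := rho_simplex. Qed.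

Lemma dispersion_min gamma1 : admissible gamma1 -> exists2 gamma, admissible gamma &
  forall gamma', admissible gamma' -> dispersion gamma <= dispersion gamma'.
Proof.
move=> adm1; pose S := [set (dispersion gamma)%:E | gamma in admissible].
have Sfin : ereal_inf S \is a fin_num.
  rewrite ge0_fin_numE; last first.
    apply: le_ereal_inf_tmp => _ [gamma _ <-]; rewrite lee_fin sumr_ge0// => i _.
    by rewrite mulr_ge0// sqr_ge0.
  apply: (@le_lt_trans _ _ (dispersion gamma1)%:E); last exact: ltry.
  by apply: ereal_inf_lbound; exists gamma1.
have /esym SE := fineK Sfin.
have /choice[gam hgam] : forall k, exists gamma, admissible gamma /\
    dispersion gamma <= fine (ereal_inf S) + k.+1%:R^-1.
  by move=> k; have [_ [gamma ag <-] hk] := ereal_inf_adherent_seq SE k; exists gamma.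
have [U [UU ooU [gamma cgamma hU]]] :=
  coupling_compact (fun i => gm_polish (W i)) (fun k => (hgam k).1.1).
have UP : ProperFilter U by exact: ultra_proper.
exists gamma.
  split => // i j; rewrite -[LHS]fineK ?uh_fin//; congr EFin.
  have := hU (uh i j) (fun k => gauge_measurable (uh_gauge i j k))
    (fun k => gauge_norm (uh_gauge i j k)).
  (* The constraint norms are zero along the whole sequence, hence also at the limit. *)
  under eq_fun do rewrite (hgam _).1.2.
  by move=> /(cvg_lim (@Rhausdorff R)) <-; rewrite lim_cst.
move=> gamma' ag'; apply: (@le_trans _ _ (fine (ereal_inf S))); last first.
  by rewrite -lee_fin -SE; apply: ereal_inf_lbound; exists gamma'.
apply: (ultra_lim_le UP ooU (fun k => (hgam k).2)).
apply: (@cvg_big _ _ +%R 0) => [|i _]; first exact: add_continuous.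
apply: cvgM; first exact: cvg_cst.
have hi := hU (ug i) (fun k => gauge_measurable (ug_gauge i k))
    (fun k => gauge_norm (ug_gauge i k)).
under eq_fun do rewrite expr2.
by rewrite expr2; exact: cvgM.
Qed.

Let GOm (Z : gmSpace R) : ptopologicalType := glued W Z.

Let forget_cts (Z : gmSpace R) : continuous (fun w : GOm Z => (fun i => w (Some i)) : Om).
Proof.
apply: (@prod_continuous (GOm Z) _ T) => i.
exact: (@pr_continuous _ (glue_space Z (fun i => W i : ptopologicalType)) (Some i)).
Qed.

Lemma admissible_below (F : tspace (gm_class Y)) : exists2 gamma, admissible gamma &
  ((dispersion gamma)%:E <= tbary_obj rho (fun i => tclass (r i)) F)%E.
Proof.
pose Z : gmSpace R := tg_base (trepr F).
pose f : borel2 Z -> R := @tg_fun R (gm_class Y) (trepr F).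
have mf : measurable_fun setT f by exact: gauge_measurable (tg_funP (trepr F)).
have mZ := @measurable_gm_gauge R Z.
have /dependent_function_choice[sigma hs] := fun i => tdist_attained (r i) F.
have [Gam hGam] := glue_plans i0 sigma.
pose cq := @forget_cts Z.
have mq := continuous_borel cq.
pose gamma : probability (borel Om) R := push_prob Gam mq.
have cW i : continuous (fun w : GOm Z => w (Some i) : W i).
  exact: (@pr_continuous _ (glue_space Z (fun i => W i : ptopologicalType)) (Some i)).
have cZ : continuous (fun w : GOm Z => w None : Z).
  exact: (@pr_continuous _ (glue_space Z (fun i => W i : ptopologicalType)) None).
have cgamma : coupling (fun i => gm_law (W i)) gamma.
  move=> i; have := pushes_to_comp (continuous_borel (@fst_continuous (W i) Z))
    (hGam i) (plan_fst (sigma i)).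
  by move=> hc A mA; exact: hc.
have mgW i : measurable_fun setT
    (fun z : borel2 (GOm Z) => g i (z.1 (Some i), z.2 (Some i))).
  exact: (measurable_pullback (cW i) (@mg i)).
have mhW i : measurable_fun setT
    (fun z : borel2 (GOm Z) => h i (z.1 (Some i), z.2 (Some i))).
  exact: (measurable_pullback (cW i) (@mh i)).
have mhZ : measurable_fun setT
    (fun z : borel2 (GOm Z) => @gm_gauge R Z (z.1 None, z.2 None)).
  exact: (measurable_pullback cZ mZ).
have mfZ : measurable_fun setT
    (fun z : borel2 (GOm Z) => f (z.1 None, z.2 None)).
  exact: (measurable_pullback cZ mf).
(* Each [sigma i] has zero distortion, so under the gluing every copy of h agrees with the gauge of
   [Z], and thus with every other copy. *)
have hh0 i : N (sq Gam) (fun z : borel2 (GOm Z) =>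
    h i (z.1 (Some i), z.2 (Some i)) - @gm_gauge R Z (z.1 None, z.2 None)) = 0%E.
  have := L2_cost_push (cW i) cZ (hGam i) (@mh i) mZ.
  by move=> <-; exact: (hs i).1.
have pushN u : measurable_fun setT u -> N (sq gamma) u =
    N (sq Gam) (fun z : borel2 (GOm Z) =>
      u ((fun i => z.1 (Some i)) : Om, (fun i => z.2 (Some i)) : Om)).
  by move=> mu_; rewrite -(pushes_Lnorm mq (push_probE Gam mq) mu_).
exists gamma.
  split => // i j; rewrite pushN; last first.
    by apply: measurable_coordinate_sum => k; exact: gauge_measurable (uh_gauge i j k).
  apply/eqP; rewrite eq_le Lnorm_ge0 andbT.
  rewrite (eq_Lnorm _ _ (g := EFin \o (fun z : borel2 (GOm Z) =>
    h i (z.1 (Some i), z.2 (Some i)) - h j (z.1 (Some j), z.2 (Some j)))%R)); last first.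
    by move=> z /=; rewrite uhE.
  apply: le_trans (L2norm_triangle (sq Gam) (mhW i) mhZ (mhW j)) _.
  by rewrite hh0 add0e L2normC hh0.
rewrite dispersionE//.
have -> : (\sum_i (rho i)%:E * N (sq gamma) (coordinate_sum (ug i)) ^+ 2 =
    \sum_i (rho i)%:E * N (sq Gam) (fun z : borel2 (GOm Z) =>
      g i (z.1 (Some i), z.2 (Some i)) -
      \sum_k rho k * g k (z.1 (Some k), z.2 (Some k))) ^+ 2)%E.
  apply: eq_bigr => i _; rewrite pushN; last first.
    by apply: measurable_coordinate_sum => k; exact: gauge_measurable (ug_gauge i k).
  by congr (_ * _ ^+ 2)%E; apply: eq_Lnorm => z /=; rewrite ugE.
(* The competitor for the mean is c = h_Z + f. Then g_i - c is (g_i - h_i) - f plus h_i - h_Z; the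
   former has norm at most the tangent distance and the latter is null. *)
apply: le_trans
  (weighted_mean_L2norm rho_simplex (sq Gam) mgW (measurable_funD mhZ mfZ)) _.
apply: lee_sum => i _; apply: lee_wpmul2l; first by rewrite lee_fin.
rewrite lee_sqr; [|exact: Lnorm_ge0|exact: tdist_ge0].
apply: le_trans (hs i).2.
have mr : measurable_fun setT (@tg_fun R (gm_class Y) (r i)).
  exact: gauge_measurable (tg_funP (r i)).
rewrite (L2_cost_push (cW i) cZ (hGam i) mr mf).
rewrite (eq_Lnorm _ _ (g := EFin \o (fun z : borel2 (GOm Z) =>
  ((g i (z.1 (Some i), z.2 (Some i)) - h i (z.1 (Some i), z.2 (Some i))) -
   f (z.1 None, z.2 None))
  + (h i (z.1 (Some i), z.2 (Some i)) - @gm_gauge R Z (z.1 None, z.2 None)))%R)); last first.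
  by move=> z /=; congr EFin; ring.
apply: le_trans (L2normD _ _ _) _.
- by apply: measurable_funB => //; exact: measurable_funB.
- exact: measurable_funB.
by rewrite hh0 adde0.
Qed.

Lemma admissible_above gamma : admissible gamma -> exists2 pi' : forall i, plan Y (X i),
  forall i, plan_equiv (pi' i) (pi i) & exists gamma' : gluing pi',
  (tbary_obj rho (fun i => tclass (r i)) (tclass (mean_residual n_gt0 gamma' rho)) <=
   (dispersion gamma)%:E)%E.
Proof.
move=> [cgamma gamma0].
have cW i : continuous (fun w : Om => w i : W i) by exact: (@pr_continuous _ T i).
pose y i (w : Om) : Y := (w i).1.
pose x i (w : Om) : X i := (w i).2.
have cy i : continuous (y i).
  by move=> w; apply: (@continuous_comp Om (W i) Y); [exact: cW|exact: fst_continuous].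
have cx i : continuous (x i).
  by move=> w; apply: (@continuous_comp Om (W i) (X i)); [exact: cW|exact: snd_continuous].
have hy i : pushes_to gamma (y i : borel Om -> borel Y) (gm_law Y).
  exact: (pushes_to_comp (continuous_borel (@fst_continuous Y (X i)))
    (cgamma i) (plan_fst (pi i))).
have hx i : pushes_to gamma (x i : borel Om -> borel (X i)) (gm_law (X i)).
  exact: (pushes_to_comp (continuous_borel (@snd_continuous Y (X i)))
    (cgamma i) (plan_snd (pi i))).
have hyx i : pushes_to gamma
    ((fun w => (y i w, x i w)) : borel Om -> borel (Y * X i)%type) (pi i).
  move=> A mA; rewrite -(cgamma i A mA) /pushforward; congr (gamma _).
  by apply/seteqP; split => w /=; rewrite /y /x; case: (w i).
have mY := @measurable_gm_gauge R Y.
have mX i := @measurable_gm_gauge R (X i).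
have hh0 i j : N (sq gamma) (fun z : borel2 Om =>
    @gm_gauge R Y (y i z.1, y i z.2) - @gm_gauge R Y (y j z.1, y j z.2)) = 0%E.
  by rewrite -[RHS](gamma0 i j); apply: eq_Lnorm => z /=; rewrite uhE.
have mhy i : measurable_fun setT
    (fun z : borel2 Om => @gm_gauge R Y (y i z.1, y i z.2)).
  exact: (measurable_pullback (cy i) mY).
have mgx i : measurable_fun setT
    (fun z : borel2 Om => @gm_gauge R (X i) (x i z.1, x i z.2)).
  exact: (measurable_pullback (cx i) (mX i)).
(* The copy [y i0] serves as common base point for all [x i]. Replacing [y i] by it leaves the
   distortion unchanged, as both give the same values of h almost surely. *)
pose pi' i : plan Y (X i) := plan_of (cy i0) (cx i) (hy i0) (hx i).
exists pi' => [i|].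
  split.
  - apply/eqP; rewrite eq_le GW_le andbT -(pi_opt i).
    rewrite /FGW (L2_cost_push (cy i0) (cx i) (plan_of_pushes _ _ _ _) mY (mX i)).
    rewrite (L2_cost_push (cy i) (cx i) (hyx i) mY (mX i)).
    apply: le_trans (L2norm_triangle (sq gamma) (mhy i0) (mhy i) (mgx i)) _.
    by rewrite hh0 add0e.
  - exact: pi_opt.
  (* The law of (y_i, y_i0) is a self-plan without distortion, and the law of (y_i, y_i0, x_i)
     realises [pi' i] as a melting of it with [pi i]. *)
  pose sigma : plan Y Y := plan_of (cy i) (cy i0) (hy i) (hy i0).
  have sigma0 : FGW sigma = 0%E.
    by rewrite /FGW (L2_cost_push (cy i) (cy i0) (plan_of_pushes _ _ _ _) mY mY).
  exists sigma.
    by apply/eqP; rewrite eq_le GW_le andbT sigma0 GW_ge0.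
  have c3 : continuous (fun w : Om => ((y i w, y i0 w), x i w) : (Y * Y * X i)%type).
    exact: (pair_continuous (pair_continuous (cy i) (cy i0)) (cx i)).
  exists (push_prob gamma (continuous_borel c3)); split => //.
  by move=> A mA; exact: hyx.
have cg : continuous (fun w : Om =>
    (y i0 w, (fun i => x i w) : prod_topology X) : (Y * prod_topology X)%type).
  by apply: (pair_continuous (cy i0)); exact: prod_continuous.
have hmarg i : pushes_to (push_prob gamma (continuous_borel cg))
   ((fun w => (w.1, w.2 i)) :
       borel (Y * prod_topology X)%type -> borel (Y * X i)%type) (pi' i).
  by [].
pose gamma' : gluing pi' := Gluing hmarg.
exists gamma'; rewrite dispersionE//.
apply: lee_sum => i _; apply: lee_wpmul2l; first by rewrite lee_fin.
rewrite lee_sqr; [|exact: tdist_ge0|exact: Lnorm_ge0].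
pose m : tangent (gm_class Y) := mean_residual n_gt0 gamma' rho.
have hm : pushes_to gamma
    ((fun w => (y i0 w, fun i => x i w)) : borel Om -> borel (tg_base m))
    (gm_law (tg_base m)).
  by [].
have cm : continuous ((fun w : Om => (y i0 w, fun i => x i w)) : Om -> tg_base m) := cg.
(* The joint law under [gamma] of (y_i, x_i) and the glued point: a zero-distortion plan, whose cost
   bounds the tangent distance. *)
pose tau : plan (W i) (tg_base m) := plan_of (cW i) cm (cgamma i) hm.
have tau0 : FGW tau = 0%E.
  rewrite /FGW (L2_cost_push (cW i) cm (plan_of_pushes _ _ _ _)
    (@measurable_gm_gauge R (W i)) (@measurable_gm_gauge R (tg_base m))).
  exact: hh0.
apply: le_trans (@tdist_le R Y (r i) m tau tau0) _.
have mr : measurable_fun setT (@tg_fun R (gm_class Y) (r i)).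
  exact: gauge_measurable (tg_funP (r i)).
have mm : measurable_fun setT (@tg_fun R (gm_class Y) m).
  exact: gauge_measurable (tg_funP m).
rewrite (L2_cost_push (cW i) cm (plan_of_pushes _ _ _ _) mr mm).
(* The difference of the tangents is g_i - m_rho plus a difference of two copies of h, which is
   null. *)
rewrite (eq_Lnorm _ _ (g := EFin \o (fun z : borel2 Om =>
  coordinate_sum (ug i) z +
  (@gm_gauge R Y (y i0 z.1, y i0 z.2) - @gm_gauge R Y (y i z.1, y i z.2)))%R)); last first.
  move=> z; rewrite /= ugE; congr EFin; rewrite /y /x /g /=.
  set a := gm_gauge _; set b := gm_gauge _; set c := \sum_k _; set d := gm_gauge _.
  by ring.
apply: le_trans (L2normD _ _ _) _.
- by apply: measurable_coordinate_sum => k; exact: gauge_measurable (ug_gauge i k).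
- exact: measurable_funB.
by rewrite hh0 adde0.
Qed.

End Barycenter.

Theorem theorem5p3 (R : realType) (N : nat) (N_gt0 : (0 < N)%N)
    (X : 'I_N -> gmSpace R) (Y : gmSpace R)
    (rho : 'I_N -> R) (rho_simplex : simplex rho)
    (pi : forall i, plan Y (X i)) (pi_opt : forall i, optimal (pi i)) :
  let G := fun i => tclass (residual (pi i)) in
  (exists F : tspace (gm_class Y), tbarycenter rho G F) /\
  (exists2 pi' : forall i, plan Y (X i),
     forall i, plan_equiv (pi' i) (pi i) &
     exists gamma : gluing pi',
       tbarycenter rho G (tclass (mean_residual N_gt0 gamma rho))).
Proof.
move=> G.
(* Any tangent would do here; it provides an admissible law, so that the infimum of the dispersion
   is finite. *)
have [gamma1 adm1 _] := admissible_below N_gt0 rho_simplex pi (G (Ordinal N_gt0)).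
have [gamma adm gamma_min] := dispersion_min rho_simplex adm1.
have [pi' pi'_equiv [gamma' above]] := admissible_above N_gt0 rho_simplex pi_opt adm.
have bary : tbarycenter rho G (tclass (mean_residual N_gt0 gamma' rho)).
  move=> F; apply: le_trans above _.
  have [gammaF admF] := admissible_below N_gt0 rho_simplex pi F.
  by apply: le_trans; rewrite lee_fin; exact: gamma_min.
split; first by exists (tclass (mean_residual N_gt0 gamma' rho)).
by exists pi' => //; exists gamma'.
Qed.
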